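(* Fix $N_t, N_r\in\mathbb{N}$, nonzero vectors $\mathbf{a}_t\in\mathbb{C}^{N_t}$ and $\mathbf{a}_r\in\mathbb{C}^{N_r}$, $\alpha\in\mathbb{C}\setminus\{0\}$, $\sigma^2>0$, and a matrix $\mathbf{F}\in\mathbb{C}^{N_t\times N_t}$. Put $\mathbf{\Theta}=\mathbf{F}\mathbf{F}^{\mathrm{H}}$, $\mathbf{R}_r=\mathbf{a}_r\mathbf{a}_r^{\mathrm{H}}$, $\mathbf{R}_t=\mathbf{a}_t\mathbf{a}_t^{\mathrm{H}}$, $\rho=|\alpha|^2\sigma^{-2}\,\mathrm{tr}(\mathbf{R}_r)$ and $d=\mathbf{a}_t^{\mathrm{H}}\mathbf{\Theta}\mathbf{a}_t$. For each integer $L\ge N_t$ let $\mathbf{S}_p\in\mathbb{C}^{N_t\times L}$ be a deterministic matrix with $\mathbf{S}_p\mathbf{S}_p^{\mathrm{H}}=\mathbf{I}_{N_t}$, let $\mathbf{S}_d\in\mathbb{C}^{N_t\times L}$ be a random matrix with i.i.d. circularly symmetric complex Gaussian entries of zero mean and unit variance, and let $\mathbf{X}=\mathbf{S}_p+\mathbf{F}\mathbf{S}_d$. Define the sensing mutual information $$I_s=\mathbb{E}_{\mathbf{X}}\log\left|\mathbf{I}+\frac{|\alpha|^2}{L\sigma^2}\left(\mathbf{R}_r\otimes \mathbf{R}_t^{1/2}\mathbf{X}\mathbf{X}^{\mathrm{H}}\mathbf{R}_t^{1/2}\right)\right|.$$ Let $(\delta,\tilde\delta)=(\delta_L,\tilde\delta_L)$,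 with $\delta\ge 0$ and $\tilde\delta\ge 0$, satisfy the system of fixed-point equations $$\delta=\frac{1}{L}\,\frac{d}{\rho^{-1}(1+\tilde\delta d)+\frac{\|\mathbf{a}_t\|^2}{L(1+\delta)}},\qquad \tilde\delta=\frac{1}{L}\,\frac{1}{\rho^{-1}(1+\delta)+\frac{\|\mathbf{a}_t\|^2}{L(1+\tilde\delta d)}}+\frac{L-1}{L}\,\rho\,(1+\delta)^{-1}.$$ Then, as $L\to\infty$, $$I_s=\bar I_s+\mathcal{O}(L^{-1}),$$ where $$\bar I_s=\log\left|1+\tilde\delta d+\frac{\rho\|\mathbf{a}_t\|^2}{L(1+\delta)}\right|+L\log(1+\delta)-\rho^{-1}L\,\delta\,\tilde\delta .$$
   Context: $(\cdot)^{\mathrm{H}}$ is the conjugate transpose, $\otimes$ the Kronecker product, $|\cdot|$ applied to a matrix is the determinant, $\|\cdot\|$ is the Euclidean norm, $\mathbf{R}_t^{1/2}$ is the positive semidefinite square root, and $\log$ is the natural logarithm. $\mathcal{O}(L^{-1})$ means bounded in absolute value by $C/L$ for all sufficiently large $L$, where the constant $C$ may depend on the fixed quantities $N_t,N_r,\mathbf{a}_t,\mathbf{a}_r,\alpha,\sigma^2,\mathbf{F}$. Interpretation: $\mathbf{X}$ is a transmitted signal over $L$ time slots made of deterministic pilots $\mathbf{S}_p$ and precoded random data $\mathbf{F}\mathbf{S}_d$; $\mathbf{a}_t,\mathbf{a}_r$ are the transmit and receive steering vectors of a single target with complex path gain $\alpha$; $\sigma^2$ is the noise power. *)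

(* Defs.v *)
From HB Require Import structures.
From mathcomp Require Import all_boot all_order all_algebra.
From mathcomp Require Export sesquilinear spectral.
From mathcomp Require Export complex mxtens.
From mathcomp Require Export all_classical all_reals all_analysis.

Set Implicit Arguments.
Unset Strict Implicit.
Unset Printing Implicit Defensive.

Import Order.TTheory GRing.Theory Num.Theory.

Local Open Scope classical_set_scope.
Local Open Scope complex_scope.
Local Open Scope sesquilinear_scope.
Local Open Scope ring_scope.

Section LinearAlgebra.
Context {R : realType}.
Implicit Types n : nat.

Definition enorm n (v : 'cV[R[i]]_n) : R :=
  Num.sqrt (\sum_(k < n) ComplexField.Normc.normc (v k 0) ^+ 2).

(* On [R[i]], [0 <= z] means that [z] is real and nonnegative. *)
Definition psdmx n (A : 'M[R[i]]_n) : Prop :=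
  A \is hermsymmx /\ forall v : 'cV[R[i]]_n, 0 <= (v^t* *m A *m v) 0 0.

(* A positive semidefinite matrix has exactly one such root. *)
Definition is_psd_sqrt n (A B : 'M[R[i]]_n) : Prop := psdmx B /\ B *m B = A.

End LinearAlgebra.

Section ComplexGaussian.
Context {R : realType} {disp : measure_display} {T : measurableType disp}.
Variable P : probability T R.

(* Measurability and laws of complex random variables are expressed on
   [R * R], with its product sigma-algebra, through this identification. *)
Definition reim (z : R[i]) : R * R := (complex.Re z, complex.Im z).

(* The circularly symmetric law CN(0, 1): the real and imaginary parts are
   independent centered Gaussians of variance 1/2.  The second argument of
   [normal_prob] is the standard deviation. *)
Definition std_complex_gaussian : set (R * R) -> \bar R :=
  (normal_prob 0 (Num.sqrt 2^-1) \x normal_prob 0 (Num.sqrt 2^-1))%E.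

(* Independence is the product rule for the whole family of entries; taking
   some of the [B i j] to be [setT] yields it for every subfamily. *)
Definition iid_std_complex_gaussian m n (S : T -> 'M[R[i]]_(m, n)) : Prop :=
  [/\ forall i j, measurable_fun [set: T] (fun w => reim (S w i j)),
      forall i j (B : set (R * R)), measurable B ->
        P [set w | B (reim (S w i j))] = std_complex_gaussian B
    & forall B : 'I_m -> 'I_n -> set (R * R),
        (forall i j, measurable (B i j)) ->
        P [set w | forall i j, B i j (reim (S w i j))] =
        (\prod_(i < m) \prod_(j < n) P [set w | B i j (reim (S w i j))])%E].

End ComplexGaussian.

Section Sensing.
Context {R : realType}.

Definition outer n (a : 'cV[R[i]]_n) : 'M[R[i]]_n := a *m a^t*.

(* The complex numbers under [complex.Re] in [snr] and [qform] are real: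
   they are the trace and a value of the quadratic form of a positive
   semidefinite matrix. *)
Definition snr Nr (ar : 'cV[R[i]]_Nr) (alpha : R[i]) (sigma2 : R) : R :=
  ComplexField.Normc.normc alpha ^+ 2 * sigma2^-1
  * complex.Re (\tr (outer ar)).

Definition qform Nt (at_ : 'cV[R[i]]_Nt) (F : 'M[R[i]]_Nt) : R :=
  complex.Re ((at_^t* *m (F *m F^t*) *m at_) 0 0).

(* [Rt12] stands for the square root of [outer at_].  The determinant is that
   of a Hermitian matrix, hence real, and it is at least 1. *)
Definition sensing_logdet Nt Nr (ar : 'cV[R[i]]_Nr) (Rt12 : 'M[R[i]]_Nt)
    (alpha : R[i]) (sigma2 : R) (L : nat) (X : 'M[R[i]]_(Nt, L)) : R :=
  ln (complex.Re (\det (1%:M +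
    (ComplexField.Normc.normc alpha ^+ 2 / (L%:R * sigma2))%:C *:
      (outer ar *t (Rt12 *m X *m X^t* *m Rt12))))).

Definition sensing_MI Nt Nr (ar : 'cV[R[i]]_Nr) (Rt12 : 'M[R[i]]_Nt)
    (alpha : R[i]) (sigma2 : R) (L : nat)
    (disp : measure_display) (T : measurableType disp) (P : probability T R)
    (X : T -> 'M[R[i]]_(Nt, L)) : \bar R :=
  'E_P[fun w => sensing_logdet ar Rt12 alpha sigma2 (X w)]%E.

(* [d], [rho] and [na] stand for [qform], [snr] and the norm of [at_]. *)
Definition fixed_point (d rho na : R) (L : nat) (delta delta' : R) : Prop :=
  delta = L%:R^-1 *
    (d / (rho^-1 * (1 + delta' * d) + na ^+ 2 / (L%:R * (1 + delta)))) /\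
  delta' = L%:R^-1 *
    (1 / (rho^-1 * (1 + delta) + na ^+ 2 / (L%:R * (1 + delta' * d))))
    + (L%:R - 1) / L%:R * rho * (1 + delta)^-1.

Definition MI_bar (d rho na : R) (L : nat) (delta delta' : R) : R :=
  ln `|1 + delta' * d + rho * na ^+ 2 / (L%:R * (1 + delta))|
  + L%:R * ln (1 + delta) - rho^-1 * L%:R * delta * delta'.

End Sensing.

(* Main.v *)
(** The Weinstein-Aronszajn identity collapses the rank-one determinant to
    [1 + rho W / L], where [W] is the squared norm of the row [at^H X], a sum
    over the [L] independent columns of squared moduli of Gaussians.  Put
    [Y = rho W / L]; its mean is [m = rho (|at|^2 / L + d)] and its variance is
    [O(1/L)], since distinct columns are uncorrelated and each column has
    bounded fourth moments.  The tangent bounds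
      [ln (1 + m) + (y - m) / (1 + m) - (y - m)^2
         <= ln (1 + y) <= ln (1 + m) + (y - m) / (1 + m)]
    then give [|E ln (1 + Y) - ln (1 + m)| <= Var Y].  On the deterministic side
    the fixed-point equations force [L delta <= rho d] and
    [delta' = rho + O(1/L)], whence [MI_bar = ln (1 + rho d) + O(1/L)]. *)

Require Import Defs.
From mathcomp Require Import all_boot all_order all_algebra.
From mathcomp Require Import all_classical all_reals all_analysis.
(* Re-imported because [all_analysis] hides the measurable structure of [\bar R]. *)
From mathcomp Require Import measurable_realfun.
From mathcomp Require Import ring lra.
Import Order.TTheory GRing.Theory Num.Theory.
Import HBNNSimple numFieldNormedType.Exports.
Local Open Scope classical_set_scope.
Local Open Scope complex_scope.
Local Open Scope sesquilinear_scope.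
Local Open Scope ring_scope.

Set Implicit Arguments.
Unset Strict Implicit.
Unset Printing Implicit Defensive.

(** * Products of independent variables *)

(** Rank one makes elementary means sufficient: only the scalar [W] is random, so a variance bound
    replaces random-matrix limits. Both sides meet at [ln (1 + rho * d)]: the pilots shift the mean
    [m] by [rho |at|^2 / L] only, and the Lipschitz bound of [ln] on [[1, +oo[] turns this into an
    error of the same order. The main obstacle is that independence is given on events, whereas the
    variance needs expectations of products. The product rule is therefore extended from indicators
    to integrable functions, one factor at a time. Expanding [W] in the real and imaginary parts of
    the data then reduces every expectation to one-dimensional Gaussian moments of order at most
    four. The constant may depend neither on [L] nor on the pilots. Since the pilot rows are
    orthonormal, [at^H S_p] has the norm of [at] for every [L], which bounds all coefficients of the
    expansion at once; crude counting then suffices, as the number of terms per column depends on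
    [N_t] only. *)

(** Both sides are additive and monotonically continuous in [f], so agreement on indicators
    suffices. It serves twice: with [W] the product of the remaining independent factors, and with
    [W] a density. *)
Lemma ge0_integral_weighted_comp d d' (T : measurableType d)
    (T' : measurableType d') (R : realType) (mu : {measure set T -> \bar R})
    (nu : {measure set T' -> \bar R}) (X : T -> T') (W : T -> R) (c : R) :
  measurable_fun [set: T] X -> measurable_fun [set: T] W ->
  (forall t, 0 <= W t) -> 0 <= c ->
  (forall B, measurable B ->
    \int[mu]_t (\1_B (X t) * W t)%:E = c%:E * nu B)%E ->
  forall f : T' -> R, measurable_fun [set: T'] f ->
  (forall x, 0 <= f x) ->
  (\int[mu]_t (f (X t) * W t)%:E = c%:E * \int[nu]_x (f x)%:E)%E.
Proof.
move=> mX mW W0 c0 XW f mf f0.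
have mEf : measurable_fun [set: T'] (EFin \o f) by exact/measurable_EFinP.
pose g := nnsfun_approx measurableT mEf.
have ndg x : {homo (fun n => g n x) : m n / (m <= n)%N >-> m <= n}.
  by move=> m n mn; exact/lefP/nd_nnsfun_approx.
have cvg_g x : (g n x)%:E @[n --> \oo] --> (f x)%:E.
  by apply: (cvg_nnsfun_approx measurableT mEf) => // y _; rewrite lee_fin.
have step n : (\int[mu]_t (g n (X t) * W t)%:E =
               c%:E * \int[nu]_x (g n x)%:E)%E.
  transitivity (\int[mu]_t (\sum_(y \in range (g n))
      (y%:E * (\1_(g n @^-1` [set y]) (X t) * W t)%:E)))%E.
    apply: eq_integral => t _.
    rewrite [g n (X t)]fimfunE EFinM -fsumEFin// ge0_mule_fsuml//; last first.
      by move=> y; rewrite nnfun_muleindic_ge0.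
    by apply: eq_fsbigr => y _; rewrite !EFinM muleA.
  have mXB y : measurable_fun [set: T]
      (fun t => (\1_(g n @^-1` [set y]) (X t) * W t)%:E)%E.
    by apply/measurable_EFinP/measurable_funM => //; apply: (measurableT_comp _ mX).
  rewrite ge0_integral_fsum//; last 2 first.
  - by move=> y; exact: measurable_funeM.
  (* A [y] outside the range of [g n] may be negative, but its preimage is then empty and the term
     vanishes. *)
  - move=> y t _; have [[z /= <-]|/set0P/negP/negPn/eqP gy] :=
        pselect (g n @^-1` [set y] !=set0).
      by rewrite -EFinM lee_fin !mulr_ge0.
    by rewrite gy indic0 mul0r mule0.
  transitivity (\sum_(y \in range (g n))
      c%:E * (y%:E * nu (g n @^-1` [set y])))%E.
    apply: eq_fsbigr => y /set_mem[x _ gy].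
    rewrite ge0_integralZl//; last 2 first.
    - by move=> t _; rewrite lee_fin mulr_ge0.
    - by rewrite -gy lee_fin.
    by rewrite XW// muleCA.
  rewrite -ge0_mule_fsumr; last by move=> y; exact: nnsfun_mulemu_ge0.
  by rewrite integralT_nnsfun sintegralE.
have lhs : (\int[mu]_t (g n (X t) * W t)%:E @[n --> \oo] -->
            \int[mu]_t (f (X t) * W t)%:E)%E.
  have -> : (fun t => (f (X t) * W t)%:E) =
            (fun t => limn (fun n => (g n (X t) * W t)%:E)).
    apply/funext => t; apply/esym/cvg_lim => //.
    under eq_fun do rewrite EFinM.
    by rewrite EFinM; apply: cvgeZr.
  apply: cvg_monotone_convergence => //.
  - move=> n; apply/measurable_EFinP/measurable_funM => //.
    exact: (measurableT_comp _ mX).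
  - by move=> n t _; rewrite lee_fin mulr_ge0.
  - by move=> t _ m n mn; rewrite lee_fin ler_wpM2r// ndg.
have rhs : (c%:E * \int[nu]_x (g n x)%:E @[n --> \oo] -->
            c%:E * \int[nu]_x (f x)%:E)%E.
  apply: cvgeZl => //.
  have -> : (fun x => (f x)%:E) = (fun x => limn (fun n => (g n x)%:E)).
    by apply/funext => x; apply/esym/cvg_lim.
  apply: cvg_monotone_convergence => //.
  - by move=> n; apply/measurable_EFinP.
  - by move=> n t _; rewrite lee_fin.
  - by move=> t _ m n mn; rewrite lee_fin ndg.
apply: cvg_unique lhs _ => //.
by rewrite (funext step).
Qed.

Section independent_product.
Context d d' (T : measurableType d) (T' : measurableType d') (R : realType).
Variables (P : probability T R) (nu : probability T' R).
Variables (K : finType) (Z : K -> T -> T').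
Hypothesis mZ : forall k, measurable_fun [set: T] (Z k).
(** Independence and the common law [nu] in one formula: full sets at all other indices give the law
    of a single [Z k]. *)
Hypothesis indepZ : forall B : K -> set T', (forall k, measurable (B k)) ->
  P [set w | forall k, B k (Z k w)] = (\prod_k nu (B k))%E.

Let measurable_prod_comp (phi : K -> T' -> R) (p : pred K) :
  (forall k, measurable_fun [set: T'] (phi k)) ->
  measurable_fun [set: T] (fun w => \prod_(k | p k) phi k (Z k w)).
Proof.
move=> mphi; under eq_fun do rewrite big_mkcond /=.
apply: measurable_prod => k _; case: (p k) => //.
exact: (measurableT_comp (mphi k) (mZ k)).
Qed.

(* The list [s] holds the factors that are no longer required to be indicators. *)
Let ge0_expectation_prod_seq (s : seq K) (phi : K -> T' -> R) :
  (forall k, measurable_fun [set: T'] (phi k)) ->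
  (forall k x, 0 <= phi k x) ->
  (forall k, nu.-integrable [set: T'] (EFin \o phi k)) ->
  (forall k, k \notin s -> exists2 B, measurable B & phi k = \1_B) ->
  (\int[P]_w (\prod_k phi k (Z k w))%:E =
   (\prod_k (\int[nu]_x phi k x))%R%:E)%E.
Proof.
elim: s phi => [|k0 s ih] phi mphi phi0 iphi phis.
  have /choice[B BE] : forall k, exists B, measurable B /\ phi k = \1_B.
    by move=> k; have [|B mB ->] := phis k; [|exists B].
  have mB k : measurable (B k) by case: (BE k).
  pose E := [set w | forall k, B k (Z k w)].
  have mE : measurable E.
    have -> : E = \bigcap_(k in [set: K]) (Z k @^-1` B k).
      by apply/seteqP; split => [w Ew k _|w Ew k]; [exact: Ew|exact: (Ew k I)].
    apply: fin_bigcap_measurable => // k _.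
    by rewrite -[X in measurable X]setTI; exact: mZ.
  transitivity (\int[P]_w (\1_E w)%:E)%E.
    apply: eq_integral => w _; congr EFin.
    rewrite indicE; have [/set_mem Ew|/negP nEw] := boolP (w \in E).
      by rewrite big1// => k _; rewrite (BE k).2 indicE mem_set//; exact: Ew.
    have [k nBk] : exists k, ~ B k (Z k w).
      by apply/existsNP => h; apply: nEw; rewrite inE.
    by rewrite (bigD1 k)//= (BE k).2 indicE memNset// mul0r.
  rewrite integral_indic// setIT.
  transitivity (\prod_k nu (B k))%E; first exact: indepZ.
  rewrite -prodEFin.
  apply: eq_bigr => k _; rewrite (BE k).2 /Rintegral integral_indic// setIT.
  by rewrite fineK// fin_num_measure.
pose psi := \prod_(k | k != k0) \int[nu]_x phi k x.
have psi0 : 0 <= psi by apply: prodr_ge0 => k _; exact: Rintegral_ge0.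
under eq_integral do rewrite (bigD1 k0)//=.
rewrite [in RHS](bigD1 k0)//= -/psi mulrC.
rewrite (@ge0_integral_weighted_comp _ _ _ _ _ P nu (Z k0)
  (fun w => \prod_(k | k != k0) phi k (Z k w)) psi)//.
- rewrite EFinM /Rintegral fineK//.
  exact: (integrable_fin_num measurableT (iphi k0)).
- exact: measurable_prod_comp.
- by move=> w; exact: prodr_ge0.
move=> B mB.
(* Testing the weighted identity on a set [B] turns the factor at [k0] into an indicator; [k0] then
   leaves the list and [ih] applies. *)
pose phi' k := if k == k0 then \1_B else phi k.
have phi'E k : k != k0 -> phi' k = phi k by rewrite /phi' => /negbTE ->.
transitivity (\int[P]_w (\prod_k phi' k (Z k w))%:E)%E.
  apply: eq_integral => w _; congr EFin.
  rewrite [in RHS](bigD1 k0)//= {1}/phi' eqxx; congr *%R.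
  by apply: eq_bigr => k kk0; rewrite phi'E.
rewrite ih.
- rewrite (bigD1 k0)//= {1}/phi' eqxx mulrC EFinM; congr (_ * _)%E.
    by congr EFin; apply: eq_bigr => k kk0; rewrite phi'E.
  by rewrite /Rintegral integral_indic// setIT fineK// fin_num_measure.
- by move=> k; rewrite /phi'; case: ifP.
- by move=> k x; rewrite /phi'; case: ifP.
- move=> k; rewrite /phi'; case: ifP => // _.
  exact: integrable_indic.
- move=> k ks; rewrite /phi'; case: ifPn => [_|kk0]; first by exists B.
  by apply: phis; rewrite inE negb_or kk0.
Qed.

Lemma ge0_expectation_prod (phi : K -> T' -> R) :
  (forall k x, 0 <= phi k x) ->
  (forall k, nu.-integrable [set: T'] (EFin \o phi k)) ->
  (\int[P]_w (\prod_k phi k (Z k w))%:E =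
   (\prod_k (\int[nu]_x phi k x))%R%:E)%E.
Proof.
move=> phi0 iphi; apply: (ge0_expectation_prod_seq (s := enum K)) => //.
  by move=> k; apply/measurable_EFinP/(measurable_int nu).
by move=> k; rewrite mem_enum.
Qed.

(** The nonnegative case applied to the absolute values gives a finite product of finite
    integrals. *)
Lemma integrable_prod (phi : K -> T' -> R) :
  (forall k, nu.-integrable [set: T'] (EFin \o phi k)) ->
  P.-integrable [set: T] (EFin \o fun w => \prod_k phi k (Z k w)).
Proof.
move=> iphi; apply/integrableP; split.
  apply/measurable_EFinP/measurable_prod_comp => k.
  by apply/measurable_EFinP/(measurable_int nu).
under eq_integral do rewrite /= normr_prod.
rewrite (@ge0_expectation_prod (fun k x => `|phi k x|)) ?ltry// => k.
exact: (@integrable_norm _ _ _ nu _ (phi k)).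
Qed.

(* The list [s] holds the factors that are no longer required to be
   nonnegative. *)
Let expectation_prod_seq (s : seq K) (phi : K -> T' -> R) :
  (forall k, k \notin s -> forall x, 0 <= phi k x) ->
  (forall k, nu.-integrable [set: T'] (EFin \o phi k)) ->
  \int[P]_w (\prod_k phi k (Z k w)) = \prod_k \int[nu]_x phi k x.
Proof.
elim: s phi => [|k0 s ih] phi phis iphi.
  by rewrite /Rintegral ge0_expectation_prod// => k; exact: phis.
(* The factor at [k0] is split into its positive and negative parts; with either one in its place,
   [k0] can leave the list. *)
pose psi f k := if k == k0 then f else phi k.
have psiE f k : k != k0 -> psi f k = phi k by rewrite /psi => /negbTE ->.
have ipos : nu.-integrable [set: T'] (EFin \o (phi k0)^\+).
  exact: integrable_funrpos.
have ineg : nu.-integrable [set: T'] (EFin \o (phi k0)^\-).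
  exact: integrable_funrneg.
have ipsi f : nu.-integrable [set: T'] (EFin \o f) ->
    forall k, nu.-integrable [set: T'] (EFin \o psi f k).
  by move=> jf k; rewrite /psi; case: ifP.
have psis f : (forall x, 0 <= f x) ->
    forall k, k \notin s -> forall x, 0 <= psi f k x.
  move=> f0 k ks x; rewrite /psi; case: ifPn => // kk0.
  by apply: phis; rewrite inE negb_or kk0.
have psi_prod f w : \prod_k psi f k (Z k w) =
    f (Z k0 w) * \prod_(k | k != k0) phi k (Z k w).
  rewrite (bigD1 k0)//= {1}/psi eqxx; congr *%R.
  by apply: eq_bigr => k kk0; rewrite psiE.
have psi_int f : \prod_k \int[nu]_x psi f k x =
    (\int[nu]_x f x) * \prod_(k | k != k0) \int[nu]_x phi k x.
  rewrite (bigD1 k0)//= {1}/psi eqxx; congr *%R.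
  by apply: eq_bigr => k kk0; rewrite psiE.
have phi0E x : phi k0 x = (phi k0)^\+ x - (phi k0)^\- x.
  exact: (congr1 (fun f => f x) (esym (funrposBneg (phi k0)))).
transitivity (\int[P]_w (\prod_k psi (phi k0)^\+ k (Z k w) -
                         \prod_k psi (phi k0)^\- k (Z k w))).
  apply: eq_Rintegral => w _; rewrite !psi_prod -mulrBl -phi0E.
  by rewrite (bigD1 k0).
rewrite RintegralB//; [|exact/integrable_prod/ipsi..].
rewrite ih; [|exact/psis/funrpos_ge0|exact: ipsi].
rewrite ih; [|exact/psis/funrneg_ge0|exact: ipsi].
rewrite !psi_int -mulrBl -RintegralB// [RHS](bigD1 k0)//=; congr *%R.
by apply: eq_Rintegral => x _; rewrite -phi0E.
Qed.

Lemma expectation_prod (phi : K -> T' -> R) :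
  (forall k, nu.-integrable [set: T'] (EFin \o phi k)) ->
  \int[P]_w (\prod_k phi k (Z k w)) = \prod_k \int[nu]_x phi k x.
Proof.
move=> iphi; apply: (expectation_prod_seq (s := enum K)) => // k.
by rewrite mem_enum.
Qed.

End independent_product.

(** * Moments of the Gaussian law of variance 1/2 *)

Section gaussian_moments.
Context {R : realType}.
Local Notation mu := (@lebesgue_measure R).

Lemma ge0_integral_normal_prob (m s : R) (f : R -> R) :
  measurable_fun [set: R] f -> (forall x, 0 <= f x) ->
  (\int[normal_prob m s]_x (f x)%:E =
   \int[mu]_x (f x * normal_pdf m s x)%:E)%E.
Proof.
move=> mf f0; rewrite -[LHS]mul1e; apply/esym.
apply: (@ge0_integral_weighted_comp _ _ _ _ _ mu (normal_prob m s) id) => //.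
- exact: measurable_normal_pdf.
- by move=> x; exact: normal_pdf_ge0.
move=> B mB; rewrite mul1e.
transitivity (\int[mu]_(x in B) (normal_pdf m s x)%:E)%E; last by [].
rewrite [RHS]integral_mkcond.
apply: eq_integral => x _; rewrite /patch indicE.
by case: ifPn => _; rewrite ?mul1r ?mul0r.
Qed.

Lemma ge0_integral_lebesgueN (f : R -> \bar R) :
  measurable_fun [set: R] f -> (forall x, 0 <= f x)%E ->
  (\int[mu]_x f (- x)%R = \int[mu]_x f x)%E.
Proof.
move=> mf f0.
have -> : (\int[mu]_x f x =
    \int[pushforward mu (-%R : _ -> measurableTypeR R)]_x f x)%E.
  by apply: eq_measure_integral => A mA _; exact/esym/lebesgue_measureN.
by rewrite ge0_integral_pushforward.
Qed.

Lemma normal_pdfN (s x : R) : s != 0 -> normal_pdf 0 s (- x) = normal_pdf 0 s x.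
Proof. by move=> s0; rewrite !normal_pdfE// /normal_fun !subr0 sqrrN. Qed.

Lemma integral_normal_prob_sym (s : R) (f : R -> R) : s != 0 ->
  measurable_fun [set: R] f -> (forall x, 0 <= f x) ->
  (\int[normal_prob 0 s]_x (f (- x))%:E = \int[normal_prob 0 s]_x (f x)%:E)%E.
Proof.
move=> s0 mf f0; rewrite !ge0_integral_normal_prob//; last first.
  exact: (measurableT_comp mf).
under eq_integral do rewrite -normal_pdfN//.
rewrite (ge0_integral_lebesgueN (f := fun x => (f x * normal_pdf 0 s x)%:E))//.
- apply/measurable_EFinP/measurable_funM => //.
  exact: measurable_normal_pdf.
- by move=> x; rewrite lee_fin mulr_ge0// normal_pdf_ge0.
Qed.

(** This antiderivative allows [x ^+ 2 * gauss_fun x], read as [x * (x * gauss_fun x)], to be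
    integrated by parts. *)
Lemma is_derive_gauss_fun (x : R) :
  is_derive x 1 (fun y => - gauss_fun y / 2) (x * gauss_fun x).
Proof.
rewrite /gauss_fun.
apply: is_derive_eq.
rewrite /GRing.scale /=; lra.
Qed.

(** The boundary term of the integration by parts: since [expR (x ^+ 2)] exceeds [x ^+ 2], it is at
    most [1 / x]. *)
Lemma cvg_natr_gauss_fun : (n.+1%:R * gauss_fun (n.+1%:R : R)) @[n --> \oo] --> (0 : R).
Proof.
apply: (squeeze_cvgr (f := cst 0) (h := harmonic)) => //; last 2 first.
- exact: cvg_cst.
- exact: cvg_harmonic.
near=> n; rewrite mulr_ge0 ?gauss_fun_ge0//= /harmonic /gauss_fun expRN.
rewrite ler_pdivrMr ?expR_gt0// ler_pdivlMl//.
by rewrite (le_trans _ (expR_ge1Dx _))// -expr2 lerDr.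
Unshelve. all: by end_near. Qed.

(** Integration by parts on [[0, n.+1]] leaves half the Gaussian integral and a vanishing boundary
    term. Using [n.+1] keeps the interval nondegenerate. *)
Lemma integral0y_sqr_gauss :
  (\int[mu]_(x in `[0%R, +oo[) (x ^+ 2 * gauss_fun x)%:E =
   (Num.sqrt pi / 4)%:E)%E.
Proof.
have cg : continuous (@gauss_fun R) := @continuous_gauss_fun R.
have mg := @measurable_gauss_fun R.
have cG x : {for x, continuous (fun y : R => - gauss_fun y / 2)}.
  by apply: cvgM; [apply: cvgN; exact: cg|exact: cvg_cst].
have parts n : (\int[mu]_(x in `[0%R, n.+1%:R]) (x ^+ 2 * gauss_fun x)%:E =
    (- (n.+1%:R * gauss_fun (n.+1%:R)) / 2)%:E +
    2^-1%:E * \int[mu]_(x in `[0%R, n.+1%:R]) (gauss_fun x)%:E)%E.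
  have := @integration_by_parts R id (fun x => - gauss_fun x / 2) (cst 1)
    (fun x => x * gauss_fun x) 0 n.+1%:R.
  move=> parts; under eq_integral do rewrite expr2 -mulrA.
  rewrite parts//.
  - rewrite mul0r subr0 mulrA mulrN.
    congr (_ + _)%E.
    under eq_integral do
      rewrite mul1r [_ / 2]mulrC mulrN -mulNr EFinM.
    rewrite integralZl//; first by rewrite EFinN mulNe oppeK.
    exact: (integrableS _ _ _ (@integrableT_gauss R)).
  - by apply: continuous_subspaceT => x; exact: cvg_cst.
  - split => //; first by apply: cvg_at_right_filter; exact: cvg_id.
    by apply: cvg_at_left_filter; exact: cvg_id.
  - by move=> x _; rewrite derive1E derive_id.
  - apply: continuous_subspaceT => x; apply: cvgM; first exact: cvg_id.
    exact: cg.
  - split => //.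
    + by apply: cvg_at_right_filter; exact: cG.
    + by apply: cvg_at_left_filter; exact: cG.
  - by move=> x _; rewrite derive1E; have [] := is_derive_gauss_fun x.
pose I0 := (\int[mu]_(x in `[0%R, +oo[) (gauss_fun x)%:E)%E.
have lim1 : (\int[mu]_(x in `[0%R, n.+1%:R]) (x ^+ 2 * gauss_fun x)%:E
    @[n --> \oo] --> \int[mu]_(x in `[0%R, +oo[) (x ^+ 2 * gauss_fun x)%:E)%E.
  have := @ge0_cvgn_integral R mu (fun x => x ^+ 2 * gauss_fun x).
  rewrite -cvg_shiftS; apply => //.
    by move=> x; rewrite mulr_ge0 ?sqr_ge0 ?gauss_fun_ge0.
  exact: measurable_funM.
have lim2 : ((- (n.+1%:R * gauss_fun (n.+1%:R)) / 2)%:E +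
    2^-1%:E * \int[mu]_(x in `[0%R, n.+1%:R]) (gauss_fun x)%:E
    @[n --> \oo] --> (- 0 / 2 : R)%:E + 2^-1%:E * I0)%E.
  apply: cvgeD.
  - by rewrite /I0 integral0y_gauss.
  - apply: cvg_EFin; first exact: nearW.
    apply: cvgM; last exact: cvg_cst.
    by apply: cvgN; exact: cvg_natr_gauss_fun.
  - apply: cvgeZl => //.
    have := @ge0_cvgn_integral R mu gauss_fun (@gauss_fun_ge0 R) mg.
    by rewrite -cvg_shiftS.
have -> : (Num.sqrt pi / 4)%:E = ((- 0 / 2 : R)%:E + 2^-1%:E * I0)%E.
  by rewrite /I0 integral0y_gauss -EFinM -EFinD; congr EFin; field.
apply: cvg_unique lim2 => //.
by rewrite -(funext parts).
Qed.

Lemma integralT_sqr_gauss :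
  (\int[mu]_x (x ^+ 2 * gauss_fun x)%:E = (Num.sqrt pi / 2)%:E)%E.
Proof.
rewrite ge0_symfun_integralT//=.
- rewrite (_ : [set x | _] = `[0, +oo[%classic); last first.
    by apply/seteqP; split => x/=; rewrite in_itv/= andbT.
  by rewrite integral0y_sqr_gauss -EFinM; congr EFin; field.
- by move=> x; rewrite mulr_ge0 ?sqr_ge0 ?gauss_fun_ge0.
- move=> x; apply: cvgM; first exact: exprn_continuous.
  exact: continuous_gauss_fun.
- by move=> x/=; rewrite /gauss_fun !sqrrN.
Qed.

Local Notation hnormal := (normal_prob (0 : R) (Num.sqrt 2^-1)).

Lemma sqrt_half_neq0 : Num.sqrt (2^-1 : R) != 0.
Proof. by rewrite gt_eqF// sqrtr_gt0. Qed.

(** With variance 1/2 the exponent [x^2 / (2 s^2)] is just [x^2]. *)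
Lemma half_normal_pdfE (x : R) :
  normal_pdf 0 (Num.sqrt 2^-1) x = (Num.sqrt pi)^-1 * gauss_fun x.
Proof.
rewrite normal_pdfE ?sqrt_half_neq0// /normal_peak /normal_fun /gauss_fun.
rewrite sqr_sqrtr// subr0.
by congr ((Num.sqrt _)^-1 * expR _); field.
Qed.

(** Split [exp(-x^2)] into two factors [exp(-x^2/2)]: one is the standard normal density up to its
    peak, the other absorbs [x ^+ 4]. With [u = x^2/2], the inequality [1 + u^2/2 <= exp u] gives
    [x^4 = 4 u^2 <= 8 exp u]. *)
Lemma expr4_gauss_fun_le (x : R) :
  x ^+ 4 * gauss_fun x <= 8 * (normal_peak 1)^-1 * normal_pdf 0 1 x.
Proof.
rewrite normal_pdfE ?oner_eq0// -[leRHS]mulrA mulKf; last first.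
  by rewrite gt_eqF// normal_peak_gt0// oner_eq0.
rewrite /normal_fun /gauss_fun subr0 expr1n.
rewrite mulNr [X in _ * expR X](_ : _ = - (x ^+ 2 / 2) + - (x ^+ 2 / 2)); last by field.
rewrite expRD mulrA ler_wpM2r ?expR_ge0//.
rewrite expRN ler_pdivrMr ?expR_gt0//.
have x2 : 0 <= x ^+ 2 / 2 by rewrite divr_ge0 ?sqr_ge0.
have := expR_ge1Dxn 1 x2.
have -> : x ^+ 4 = 4 * (x ^+ 2 / 2) ^+ 2 by field.
have -> : 2`! = 2%N by []. lra.
Qed.

Lemma integrable_half_normal_expr4 :
  hnormal.-integrable [set: R] (fun x => (x ^+ 4)%:E).
Proof.
have x4 (x : R) : 0 <= x ^+ 4 by rewrite exprn_even_ge0.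
apply/integrableP; split; first exact/measurable_EFinP.
under eq_integral do rewrite gee0_abs ?lee_fin//.
rewrite ge0_integral_normal_prob//.
have := integrableZl measurableT ((Num.sqrt pi)^-1 * (8 * (normal_peak 1)^-1))
  (@integrable_normal_pdf R 0 1).
move=> ig; apply: integrable_lty => //; apply: le_integrable ig => //.
  apply/measurable_EFinP/measurable_funM => //.
  exact: measurable_normal_pdf.
move=> x _.
rewrite -EFinM lee_fin [leLHS]ger0_norm; last first.
  by apply: mulr_ge0 => //; exact: normal_pdf_ge0.
rewrite [leRHS]ger0_norm; last first.
  by rewrite !mulr_ge0 ?normal_pdf_ge0 ?invr_ge0 ?normal_peak_ge0.
rewrite half_normal_pdfE mulrCA -[leRHS]mulrA ler_wpM2l ?invr_ge0//.
exact: expr4_gauss_fun_le.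
Qed.

Lemma integrable_half_normal_expr n : (n <= 4)%N ->
  hnormal.-integrable [set: R] (fun x => (x ^+ n)%:E).
Proof.
move=> n4.
have i14 : hnormal.-integrable [set: R] (EFin \o fun x : R => 1 + x ^+ 4).
  apply: (@eq_integrable _ _ _ hnormal _ _
    (fun x : R => (cst 1%:E \+ (fun x => (x ^+ 4)%:E)) x)%E) => //.
  apply: integrableD => //; last exact: integrable_half_normal_expr4.
  exact: finite_measure_integrable_cst.
apply: le_integrable i14 => //; first exact/measurable_EFinP.
move=> x _; rewrite lee_fin normrX.
have -> : `|1 + x ^+ 4| = 1 + `|x| ^+ 4.
  have x4 : 0 <= x ^+ 4 by rewrite exprn_even_ge0.
  by rewrite -normrX !ger0_norm// addr_ge0.
have [x1|x1] := leP `|x| 1.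
  by apply: (@le_trans _ _ 1); [exact: exprn_ile1|rewrite lerDl exprn_ge0].
by rewrite (le_trans (ler_weXn2l (ltW x1) n4))// lerDr.
Qed.

(** The reflection lemma covers nonnegative functions only, so [x] is written as
    [max(x, 0) - max(-x, 0)], two parts that reflection exchanges. *)
Lemma half_normal_mean : \int[hnormal]_x x = 0.
Proof.
have i1 : hnormal.-integrable [set: R] (EFin \o id).
  exact: (@integrable_half_normal_expr 1).
have imax (f : R -> R) : measurable_fun [set: R] f ->
    (forall x, `|f x| <= `|x|) -> hnormal.-integrable [set: R] (EFin \o f).
  move=> mf fx; apply: le_integrable i1 => //; first exact/measurable_EFinP.
  by move=> x _; rewrite lee_fin.
transitivity (\int[hnormal]_x (Num.max x 0 - Num.max (- x) 0)).
  apply: eq_Rintegral => x _.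
  by rewrite /Num.max; do 2 case: ifPn; lra.
rewrite RintegralB//.
- apply/eqP; rewrite subr_eq0; apply/eqP; rewrite /Rintegral; congr fine.
  apply/esym/(@integral_normal_prob_sym _ (fun x => Num.max x 0)).
  + exact: sqrt_half_neq0.
  + exact: measurable_maxr.
  + by move=> x; rewrite le_max lexx orbT.
- apply: imax; first exact: measurable_maxr.
  by move=> x; case: (leP x 0); rewrite ?normr0.
- apply: imax; first exact: measurable_maxr.
  by move=> x; rewrite -[in leRHS]normrN; case: (leP (- x) 0); rewrite ?normr0.
Qed.

Lemma half_normal_variance : \int[hnormal]_x x ^+ 2 = 2^-1.
Proof.
rewrite /Rintegral ge0_integral_normal_prob//; last by move=> x; exact: sqr_ge0.
under eq_integral do rewrite half_normal_pdfE mulrCA EFinM.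
rewrite ge0_integralZl//.
- rewrite integralT_sqr_gauss -EFinM /= mulrA mulVf ?mul1r//.
  by rewrite gt_eqF// sqrtr_gt0 pi_gt0.
- apply/measurable_EFinP/measurable_funM => //.
  exact: measurable_gauss_fun.
- by move=> x _; rewrite lee_fin mulr_ge0 ?sqr_ge0 ?gauss_fun_ge0.
Qed.

End gaussian_moments.

(** * Quadratic forms with independent columns *)

Section real_integral_sum.
Context d (T : measurableType d) (R : realType).
Variable mu : {measure set T -> \bar R}.

Lemma integrable_sumR (I : Type) (s : seq I) (f : I -> T -> R) :
  (forall i, mu.-integrable [set: T] (EFin \o f i)) ->
  mu.-integrable [set: T] (EFin \o fun w => \sum_(i <- s) f i w).
Proof.
move=> fi.
rewrite (_ : EFin \o _ = fun w => (\sum_(i <- s) (f i w)%:E)%E); last first.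
  by apply/funext => w /=; rewrite sumEFin.
by apply: (integrable_sum measurableT) => i _; exact: fi.
Qed.

Lemma Rintegral_sumR (I : Type) (s : seq I) (f : I -> T -> R) :
  (forall i, mu.-integrable [set: T] (EFin \o f i)) ->
  \int[mu]_w (\sum_(i <- s) f i w) = \sum_(i <- s) \int[mu]_w f i w.
Proof.
move=> fi; elim: s => [|i s ih].
  by under eq_Rintegral do rewrite big_nil; rewrite Rintegral_cst// mul0r big_nil.
under eq_Rintegral do rewrite big_cons.
by rewrite RintegralD//; [rewrite ih big_cons|exact: integrable_sumR].
Qed.

Lemma integrable_mulrl (k : R) (f : T -> R) :
  mu.-integrable [set: T] (EFin \o f) ->
  mu.-integrable [set: T] (EFin \o fun w => k * f w).
Proof. by move=> /(integrableZl measurableT k). Qed.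

Lemma integrable_addr (f g : T -> R) :
  mu.-integrable [set: T] (EFin \o f) -> mu.-integrable [set: T] (EFin \o g) ->
  mu.-integrable [set: T] (EFin \o fun w => f w + g w).
Proof. by move=> mf mg; have := integrableD measurableT mf mg. Qed.

End real_integral_sum.

Lemma probability_Rintegral_cst d (T : measurableType d) (R : realType)
  (P : probability T R) (r : R) : \int[P]_w r = r.
Proof. by rewrite Rintegral_cst//= probability_setT mulr1. Qed.

Section column_quadratic_forms.
Context d (T : measurableType d) (R : realType).
Variables (P : probability T R) (nu : probability (measurableTypeR R) R).
Variables (I J : finType).
Variable Z : I * J -> T -> R.
Hypothesis mZ : forall k, measurable_fun [set: T] (Z k).
Hypothesis indepZ : forall B : I * J -> set R, (forall k, measurable (B k)) ->
  P [set w | forall k, B k (Z k w)] = (\prod_k nu (B k))%E.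
Hypothesis nuX : forall n, (n <= 4)%N ->
  nu.-integrable [set: R] (fun x => (x ^+ n)%:E).
Hypothesis nu_mean : \int[nu]_x x = 0.

(* [None] is the constant 1, so that an affine form in column [j] is a linear
   combination of atoms. *)
Definition atom (a : option I) (j : J) (w : T) : R :=
  if a is Some i then Z (i, j) w else 1.

Definition atom_exp (a : option I) (j : J) (k : I * J) : nat :=
  if a is Some i then k == (i, j) else 0.

(** The second moment of an atom: a variance for the centered variables, and 1 for the constant. *)
Definition atom_var (a : option I) : R :=
  if a is Some _ then \int[nu]_x x ^+ 2 else 1.

(** With exponents as data, products of atoms add exponents and an expectation becomes a product of
    one-variable moments. *)
Definition monomial (e : I * J -> nat) (w : T) : R := \prod_k Z k w ^+ e k.

Lemma atomE a j w : atom a j w = monomial (atom_exp a j) w.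
Proof.
case: a => [i|] /=; last by rewrite /monomial big1.
rewrite /monomial (bigD1 (i, j))//= eqxx expr1 big1 ?mulr1// => k kij.
by rewrite (negbTE kij).
Qed.

Lemma monomialD e e' w :
  monomial e w * monomial e' w = monomial (fun k => e k + e' k)%N w.
Proof. by rewrite -big_split/=; apply: eq_bigr => k _; rewrite exprD. Qed.

Lemma integrable_monomial e : (forall k, e k <= 4)%N ->
  P.-integrable [set: T] (EFin \o monomial e).
Proof.
move=> e4; apply: (@integrable_prod _ _ _ (measurableTypeR R) _ P nu _ Z mZ indepZ
  (fun k x => x ^+ e k)) => k.
exact: nuX.
Qed.

Lemma Rintegral_monomial e : (forall k, e k <= 4)%N ->
  \int[P]_w monomial e w = \prod_k \int[nu]_x x ^+ e k.
Proof.
move=> e4.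
apply: (@expectation_prod _ _ _ (measurableTypeR R) _ P nu _ Z mZ indepZ
  (fun k x => x ^+ e k)) => k.
exact: nuX.
Qed.

(** Monomials with disjoint supports are independent: at each index one exponent is 0, and the
    moment of order 0 is 1. *)
Lemma Rintegral_monomialM e e' :
  (forall k, e k + e' k <= 4)%N -> (forall k, e k = 0 \/ e' k = 0)%N ->
  \int[P]_w (monomial e w * monomial e' w) =
  (\int[P]_w monomial e w) * \int[P]_w monomial e' w.
Proof.
move=> ee4 ee0.
have e4 k : (e k <= 4)%N by rewrite (leq_trans _ (ee4 k))// leq_addr.
have e4' k : (e' k <= 4)%N by rewrite (leq_trans _ (ee4 k))// leq_addl.
under eq_Rintegral do rewrite monomialD.
rewrite !Rintegral_monomial// -big_split/=; apply: eq_bigr => k _.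
have nu1 : \int[nu]_x x ^+ 0 = 1.
  under eq_Rintegral do rewrite expr0.
  by rewrite probability_Rintegral_cst.
by case: (ee0 k) => ->; rewrite ?add0n ?addn0 nu1 ?mul1r ?mulr1.
Qed.

Lemma atom_exp_le1 a j k : (atom_exp a j k <= 1)%N.
Proof. by case: a => //= i; case: eqP. Qed.

Lemma atom_exp_eq0 a j k : k.2 != j -> atom_exp a j k = 0%N.
Proof. by case: a => //= i kj; apply/eqP; rewrite eqb0; apply: contraNN kj => /eqP ->. Qed.

Definition pair_exp (a b : option I) (j : J) k := (atom_exp a j k + atom_exp b j k)%N.

Lemma pair_exp_le2 a b j k : (pair_exp a b j k <= 2)%N.
Proof. by rewrite -[2%N]addn1 leq_add// atom_exp_le1. Qed.

Lemma atomM a b j w : atom a j w * atom b j w = monomial (pair_exp a b j) w.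
Proof. by rewrite !atomE monomialD. Qed.

(** Two distinct atoms of a column leave some variable with exponent exactly 1, and its mean is
    0. *)
Lemma Rintegral_atomM a b j :
  \int[P]_w (atom a j w * atom b j w) = (atom_var a) *+ (a == b).
Proof.
under eq_Rintegral do rewrite atomM.
rewrite Rintegral_monomial => [|k]; last exact: leq_trans (pair_exp_le2 _ _ _ _) _.
have nu0 : \int[nu]_x x ^+ 0 = 1.
  under eq_Rintegral do rewrite expr0.
  by rewrite probability_Rintegral_cst.
have nu1 : \int[nu]_x x ^+ 1 = 0 by [].
have zero (k : I * J) : pair_exp a b j k = 1%N ->
    \prod_k \int[nu]_x x ^+ pair_exp a b j k = 0.
  by move=> ek; rewrite (bigD1 k)//= ek nu1 mul0r.
case: a b zero => [i|] [i'|] zero /=.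
- have [<-|ii'] := eqVneq i i'.
    rewrite eqxx mulr1n (bigD1 (i, j))//= /pair_exp /= eqxx big1 ?mulr1//.
    by move=> k /negbTE ->.
  have -> : (Some i == Some i') = false by exact/negbTE.
  apply: (zero (i, j)); rewrite /pair_exp /= eqxx.
  by case: eqP => // -[] /eqP; rewrite (negbTE ii').
- by apply: (zero (i, j)); rewrite /pair_exp /= eqxx.
- by apply: (zero (i', j)); rewrite /pair_exp /= eqxx.
- by rewrite big1.
Qed.

(** Each pair raises a variable to a power at most 2, so two pairs, even in the same column, stay
    within the fourth moments. *)
Lemma integrable_atomMM a b j a' b' j' :
  P.-integrable [set: T]
    (EFin \o fun w => atom a j w * atom b j w * (atom a' j' w * atom b' j' w)).
Proof.
rewrite (_ : (fun w => _) =
    monomial (fun k => pair_exp a b j k + pair_exp a' b' j' k)%N); last first.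
  by apply/funext => w; rewrite !atomM monomialD.
apply: integrable_monomial => k.
exact: (leq_add (pair_exp_le2 a b j k) (pair_exp_le2 a' b' j' k)).
Qed.

Lemma integrable_atomM a b j :
  P.-integrable [set: T] (EFin \o fun w => atom a j w * atom b j w).
Proof.
have := integrable_atomMM a b j None None j.
by under eq_fun do rewrite /= !mulr1.
Qed.

Lemma Rintegral_atomMM a b j a' b' j' : j != j' ->
  \int[P]_w (atom a j w * atom b j w * (atom a' j' w * atom b' j' w)) =
  (\int[P]_w (atom a j w * atom b j w)) *
  \int[P]_w (atom a' j' w * atom b' j' w).
Proof.
move=> jj'; under eq_Rintegral do rewrite !atomM.
rewrite Rintegral_monomialM => [|k|k].
- by congr *%R; apply: eq_Rintegral => w _; rewrite atomM.
- exact: (leq_add (pair_exp_le2 a b j k) (pair_exp_le2 a' b' j' k)).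
- have [kj|kj] := eqVneq k.2 j; last by left; rewrite /pair_exp !atom_exp_eq0.
  by right; rewrite /pair_exp !atom_exp_eq0// kj.
Qed.

(** The sum on the right bounds both kinds of atoms: 1 for the constant, the fourth moment of [nu]
    for a variable. *)
Lemma Rintegral_atom4 a j :
  0 <= \int[P]_w (atom a j w ^+ 4) <= 1 + \int[nu]_x x ^+ 4.
Proof.
have nu4 : 0 <= \int[nu]_x x ^+ 4.
  by apply: Rintegral_ge0 => x _; rewrite exprn_even_ge0.
apply/andP; split; first by apply: Rintegral_ge0 => w _; rewrite exprn_even_ge0.
case: a => [i|] /=; last first.
  under eq_Rintegral do rewrite expr1n.
  by rewrite probability_Rintegral_cst lerDl.
have -> : \int[P]_w (Z (i, j) w ^+ 4) =
    \int[P]_w monomial (fun k => if k == (i, j) then 4 else 0)%N w.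
  apply: eq_Rintegral => w _; rewrite /monomial (bigD1 (i, j))//= eqxx.
  by rewrite big1 ?mulr1// => k /negbTE ->.
rewrite Rintegral_monomial => [|k]; last by case: ifP.
rewrite (bigD1 (i, j))//= eqxx big1 ?mulr1 ?lerDr// => k /negbTE ->.
under eq_Rintegral do rewrite expr0.
by rewrite probability_Rintegral_cst.
Qed.

Lemma integrable_atom4 a j : P.-integrable [set: T] (EFin \o fun w => atom a j w ^+ 4).
Proof.
have := integrable_atomMM a a j a a j.
by under eq_fun do rewrite -!expr2 -exprM.
Qed.

(** The arithmetic-geometric mean inequality for four factors reduces mixed moments to fourth
    moments of single atoms, whichever indices coincide. *)
Lemma Rintegral_atomMM_le a b j a' b' j' :
  \int[P]_w `|atom a j w * atom b j w * (atom a' j' w * atom b' j' w)| <=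
  1 + \int[nu]_x x ^+ 4.
Proof.
have amgm (x y z t : R) : `|x * y * (z * t)| <=
    4^-1 * (x ^+ 4 + y ^+ 4 + (z ^+ 4 + t ^+ 4)).
  have h1 := sqr_ge0 (x ^+ 2 - y ^+ 2); have h2 := sqr_ge0 (z ^+ 2 - t ^+ 2).
  have h3 := sqr_ge0 (x * y + z * t); have h4 := sqr_ge0 (x * y - z * t).
  by rewrite ler_norml; apply/andP; split; lra.
have i2 c k c' k' : P.-integrable [set: T]
    (EFin \o fun w => atom c k w ^+ 4 + atom c' k' w ^+ 4).
  by rewrite /comp; under eq_fun do rewrite EFinD; apply: integrableD => //;
    exact: integrable_atom4.
apply: (@le_trans _ _ (\int[P]_w (4^-1 * (atom a j w ^+ 4 + atom b j w ^+ 4 +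
    (atom a' j' w ^+ 4 + atom b' j' w ^+ 4))))).
  apply: le_Rintegral => //.
  - exact: (integrable_norm (integrable_atomMM a b j a' b' j')).
  - apply: integrable_mulrl; rewrite /comp; under eq_fun do rewrite EFinD.
    by apply: integrableD => //; exact: i2.
rewrite RintegralZl//; last first.
  rewrite /comp; under eq_fun do rewrite EFinD.
  by apply: integrableD => //; exact: i2.
rewrite !RintegralD//; try exact: integrable_atom4; try exact: i2.
have := Rintegral_atom4 a j; have := Rintegral_atom4 b j.
have := Rintegral_atom4 a' j'; have := Rintegral_atom4 b' j'.
by do 4 move=> /andP[_ ?]; lra.
Qed.

Variable alpha : bool -> J -> option I -> R.

(** In the application [c] selects the real or the imaginary part of an entry affine in column [j]
    of the data, so the two squares add up to its squared modulus. *)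
Definition col_form (j : J) (w : T) : R :=
  \sum_c (\sum_a alpha c j a * atom a j w) ^+ 2.

Let col_coef (j : J) (t : bool * (option I * option I)) : R :=
  alpha t.1 j t.2.1 * alpha t.1 j t.2.2.

Let col_atom (j : J) (t : bool * (option I * option I)) (w : T) : R :=
  atom t.2.1 j w * atom t.2.2 j w.

Let col_formE j w : col_form j w = \sum_t col_coef j t * col_atom j t w.
Proof.
rewrite -(pair_bigA _ (fun c ab => col_coef j (c, ab) * col_atom j (c, ab) w))/=.
apply: eq_bigr => c _.
rewrite -(pair_bigA _
  (fun a b => col_coef j (c, (a, b)) * col_atom j (c, (a, b)) w))/=.
rewrite expr2 mulr_suml; apply: eq_bigr => a _.
by rewrite mulr_sumr; apply: eq_bigr => b _; rewrite mulrACA.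
Qed.

Lemma integrable_col_form j : P.-integrable [set: T] (EFin \o col_form j).
Proof.
rewrite (_ : col_form j = fun w => \sum_t col_coef j t * col_atom j t w); last first.
  by apply/funext => w; rewrite col_formE.
apply: integrable_sumR => t; apply: integrable_mulrl.
exact: integrable_atomM.
Qed.

Let Rintegral_col_formE j : \int[P]_w col_form j w =
  \sum_t col_coef j t * \int[P]_w col_atom j t w.
Proof.
under eq_Rintegral do rewrite col_formE.
rewrite Rintegral_sumR; last first.
  by move=> t; apply: integrable_mulrl; exact: integrable_atomM.
by apply: eq_bigr => t _; rewrite RintegralZl//; exact: integrable_atomM.
Qed.

Lemma Rintegral_col_form j :
  \int[P]_w col_form j w = \sum_c \sum_a alpha c j a ^+ 2 * atom_var a.
Proof.
rewrite Rintegral_col_formE.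
under eq_bigr do rewrite Rintegral_atomM.
rewrite -(pair_bigA _ (fun c ab =>
  col_coef j (c, ab) * (atom_var ab.1 *+ (ab.1 == ab.2))))/=.
apply: eq_bigr => c _.
rewrite -(pair_bigA _
  (fun a b => col_coef j (c, (a, b)) * (atom_var a *+ (a == b))))/=.
apply: eq_bigr => a _; rewrite (bigD1 a)//= eqxx mulr1n big1 ?addr0 => [|b ba].
  by rewrite /col_coef /= -expr2.
by rewrite eq_sym (negbTE ba) mulr0n mulr0.
Qed.

Let col_formME j j' w : col_form j w * col_form j' w =
  \sum_t \sum_s col_coef j t * col_coef j' s * (col_atom j t w * col_atom j' s w).
Proof.
rewrite !col_formE mulr_suml; apply: eq_bigr => t _.
by rewrite mulr_sumr; apply: eq_bigr => s _; rewrite mulrACA.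
Qed.

Let integrable_col_term j j' t s : P.-integrable [set: T]
  (EFin \o fun w => col_coef j t * col_coef j' s * (col_atom j t w * col_atom j' s w)).
Proof. by apply: integrable_mulrl; exact: integrable_atomMM. Qed.

Lemma integrable_col_formM j j' :
  P.-integrable [set: T] (EFin \o fun w => col_form j w * col_form j' w).
Proof.
under eq_fun do rewrite col_formME.
by do 2 (apply: integrable_sumR => ?).
Qed.

Let Rintegral_col_formME j j' : \int[P]_w (col_form j w * col_form j' w) =
  \sum_t \sum_s col_coef j t * col_coef j' s *
    \int[P]_w (col_atom j t w * col_atom j' s w).
Proof.
under eq_Rintegral do rewrite col_formME.
rewrite Rintegral_sumR => [|t]; last by apply: integrable_sumR.
apply: eq_bigr => t _; rewrite Rintegral_sumR//; apply: eq_bigr => s _.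
by rewrite RintegralZl//; exact: integrable_atomMM.
Qed.

Lemma Rintegral_col_formM j j' : j != j' ->
  \int[P]_w (col_form j w * col_form j' w) =
  (\int[P]_w col_form j w) * \int[P]_w col_form j' w.
Proof.
move=> jj'; rewrite Rintegral_col_formME !Rintegral_col_formE mulr_suml.
apply: eq_bigr => t _; rewrite mulr_sumr; apply: eq_bigr => s _.
by rewrite Rintegral_atomMM// mulrACA.
Qed.

Variable B : R.
Hypothesis alphaB : forall c j a, `|alpha c j a| <= B.

(** A column form expands into one term per triple [(c, (a, b))], with coefficient at most [B ^+ 2].
    Its square has the square of that number of terms, each with a mixed moment at most [1 +
    \int[nu]_x x ^+ 4]. The bound does not involve the number of columns. *)
Definition col_sqr_bound : R :=
  (#|{: bool * (option I * option I)}|%:R * B ^+ 2) ^+ 2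
  * (1 + \int[nu]_x x ^+ 4).

Lemma Rintegral_col_form_sqr_le j :
  \int[P]_w (col_form j w * col_form j w) <= col_sqr_bound.
Proof.
have B0 : 0 <= B by apply: le_trans (alphaB true j None).
have coefB t : `|col_coef j t| <= B ^+ 2.
  by rewrite normrM expr2 ler_pM.
have -> : col_sqr_bound = \sum_(t : bool * (option I * option I))
    \sum_(s : bool * (option I * option I))
    B ^+ 2 * B ^+ 2 * (1 + \int[nu]_x x ^+ 4).
  rewrite sumr_const sumr_const -mulr_natl -[X in _ * X]mulr_natl.
  by rewrite /col_sqr_bound; ring.
rewrite Rintegral_col_formME; apply: ler_sum => t _; apply: ler_sum => s _.
apply: le_trans (ler_norm _) _; rewrite normrM; apply: ler_pM => //.
  by rewrite normrM ler_pM.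
apply: le_trans (Rintegral_atomMM_le t.2.1 t.2.2 j s.2.1 s.2.2 j).
by apply: le_normr_Rintegral => //; exact: integrable_atomMM.
Qed.

Definition total_form (w : T) : R := \sum_j col_form j w.

Lemma integrable_total_form : P.-integrable [set: T] (EFin \o total_form).
Proof. by apply: integrable_sumR => j; exact: integrable_col_form. Qed.

Lemma Rintegral_total_form : \int[P]_w total_form w =
  \sum_j \sum_c \sum_a alpha c j a ^+ 2 * atom_var a.
Proof.
rewrite Rintegral_sumR => [|j]; last exact: integrable_col_form.
by apply: eq_bigr => j _; rewrite Rintegral_col_form.
Qed.

Let total_form_sqrE w :
  total_form w ^+ 2 = \sum_j \sum_j' col_form j w * col_form j' w.
Proof.
rewrite expr2 mulr_suml; apply: eq_bigr => j _.
by rewrite mulr_sumr.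
Qed.

Let integrable_total_form_sqr :
  P.-integrable [set: T] (EFin \o fun w => total_form w ^+ 2).
Proof.
rewrite (_ : (fun w => _) =
    fun w => \sum_j \sum_j' col_form j w * col_form j' w); last first.
  by apply/funext => w; exact: total_form_sqrE.
by do 2 (apply: integrable_sumR => ?); exact: integrable_col_formM.
Qed.

Let total_form_devE (c : R) w : (total_form w - c) ^+ 2 =
  total_form w ^+ 2 + (- (2 * c) * total_form w + c ^+ 2).
Proof. by ring. Qed.

Lemma integrable_total_form_dev (c : R) :
  P.-integrable [set: T] (EFin \o fun w => (total_form w - c) ^+ 2).
Proof.
rewrite /comp; under eq_fun do rewrite total_form_devE !EFinD.
apply: integrableD => //; apply: integrableD => //.
  exact: (integrable_mulrl (- (2 * c)) integrable_total_form).
exact: finite_measure_integrable_cst.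
Qed.

(** The covariances of distinct columns vanish; on the diagonal the squared means are dropped and
    only the second moments are kept. *)
Lemma total_form_variance_le :
  \int[P]_w (total_form w - \int[P]_w' total_form w') ^+ 2 <=
  #|J|%:R * col_sqr_bound.
Proof.
set m := \int[P]_w total_form w.
have icst : P.-integrable [set: T] (EFin \o fun w => m ^+ 2).
  exact: finite_measure_integrable_cst.
have ilin : P.-integrable [set: T] (EFin \o fun w => - (2 * m) * total_form w).
  exact: (integrable_mulrl (- (2 * m)) integrable_total_form).
under eq_Rintegral do rewrite total_form_devE.
rewrite RintegralD//; last first.
  by rewrite /comp; under eq_fun do rewrite EFinD; exact: integrableD.
rewrite RintegralD// RintegralZl//; last exact: integrable_total_form.
rewrite probability_Rintegral_cst -/m.
have -> : \int[P]_w total_form w ^+ 2 =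
    \sum_j \sum_j' \int[P]_w (col_form j w * col_form j' w).
  under eq_Rintegral do rewrite total_form_sqrE.
  rewrite Rintegral_sumR => [|j]; last first.
    by apply: integrable_sumR => j'; exact: integrable_col_formM.
  apply: eq_bigr => j _; rewrite Rintegral_sumR// => j'.
  exact: integrable_col_formM.
have -> : m = \sum_j \int[P]_w col_form j w.
  by rewrite /m Rintegral_sumR// => j; exact: integrable_col_form.
set S := \sum_j \int[P]_w col_form j w.
have -> : #|J|%:R * col_sqr_bound = \sum_(j : J) col_sqr_bound.
  by rewrite sumr_const mulr_natl.
rewrite [leLHS](_ : _ = \sum_j \sum_j' \int[P]_w (col_form j w * col_form j' w)
  - S * S); last by ring.
rewrite [S * S]mulr_suml -sumrB; apply: ler_sum => j _.
rewrite mulr_sumr -sumrB (bigD1 j)//= big1 ?addr0 => [|j' jj']; last first.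
  by rewrite Rintegral_col_formM ?subrr// eq_sym.
by rewrite lerBlDr (le_trans (Rintegral_col_form_sqr_le j))// lerDl -expr2 sqr_ge0.
Qed.

End column_quadratic_forms.

(** * Logarithm and deterministic equivalent *)

Section logarithm.
Context {R : realType}.
Implicit Types x y m : R.

Lemma lnB_le x y : 0 < x -> 0 < y -> ln x - ln y <= (x - y) / y.
Proof.
move=> x0 y0; rewrite -ln_div ?posrE// mulrBl divff ?gt_eqF//.
have xy : 0 < x / y by rewrite divr_gt0.
by rewrite -[X in ln X](subrKC 1) le_ln1Dx// ltrBrDr addrC subrr.
Qed.

Lemma ln_lipschitz x y : 1 <= x -> 1 <= y -> `|ln x - ln y| <= `|x - y|.
Proof.
move=> x1 y1.
have aux (u v : R) : 1 <= u -> 1 <= v -> ln u - ln v <= `|u - v|.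
  move=> u1 v1; have u0 : 0 < u by exact: lt_le_trans u1.
  have v0 : 0 < v by exact: lt_le_trans v1.
  apply: (le_trans (lnB_le u0 v0)); rewrite ler_pdivrMr//.
  by apply: le_trans (ler_norm _) _; rewrite ler_peMr.
by rewrite ler_norml lerNl opprB aux// distrC aux.
Qed.

Lemma ln1D_upper x m : 0 <= x -> 0 <= m ->
  ln (1 + x) <= ln (1 + m) + (x - m) / (1 + m).
Proof.
move=> x0 m0; rewrite -lerBlDl.
have -> : x - m = (1 + x) - (1 + m) by ring.
by apply: lnB_le; rewrite ltr_wpDr.
Qed.

(** The tangent bound with the two points exchanged has slope [1 / (1 + x)]. Replacing it by
    [1 / (1 + m)] costs [(x - m)^2 / ((1 + m)(1 + x))], whose denominator is at least 1. *)
Lemma ln1D_lower x m : 0 <= x -> 0 <= m ->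
  ln (1 + m) + (x - m) / (1 + m) - (x - m) ^+ 2 <= ln (1 + x).
Proof.
move=> x0 m0; have x1 : 0 < 1 + x by rewrite ltr_wpDr.
have m1 : 0 < 1 + m by rewrite ltr_wpDr.
have := lnB_le m1 x1; rewrite (_ : _ - (1 + x) = m - x); last by ring.
move=> h.
have -> : (x - m) / (1 + m) =
    (x - m) / (1 + x) + (x - m) ^+ 2 / ((1 + m) * (1 + x)).
  by field; rewrite !gt_eqF.
suff : (x - m) ^+ 2 / ((1 + m) * (1 + x)) <= (x - m) ^+ 2.
  by rewrite -(opprB m x) mulNr sqrrN; lra.
rewrite ler_pdivrMr ?mulr_gt0// ler_peMr ?sqr_ge0//.
by rewrite mulrDl mul1r -addrA lerDl addr_ge0// mulr_ge0// ltW.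
Qed.

(** The linear tangent term integrates to 0 because [m] is the mean, so only the square survives.
    The bound [0 <= ln (1 + Y) <= Y] makes the expectation finite, which [e] records. *)
Lemma expectation_ln1D d (T : measurableType d) (P : probability T R)
    (Y : T -> R) (m : R) :
  (forall w, 0 <= Y w) -> P.-integrable [set: T] (EFin \o Y) ->
  \int[P]_w Y w = m ->
  P.-integrable [set: T] (EFin \o fun w => (Y w - m) ^+ 2) ->
  exists2 e : R, 'E_P[fun w => ln (1 + Y w)]%E = e%:E &
    `|e - ln (1 + m)| <= \int[P]_w (Y w - m) ^+ 2.
Proof.
move=> Y0 iY Ym iV.
have m0 : 0 <= m by rewrite -Ym; exact: Rintegral_ge0.
have mY : measurable_fun [set: T] Y by apply/measurable_EFinP/(measurable_int P).
have iln : P.-integrable [set: T] (EFin \o fun w => ln (1 + Y w)).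
  apply: le_integrable iY => //.
    apply/measurable_EFinP/(measurableT_comp (@measurable_ln R)).
    exact: measurable_funD.
  move=> w _; rewrite lee_fin !ger0_norm ?ln_ge0 ?lerDl//.
  by rewrite le_ln1Dx// (lt_le_trans _ (Y0 w)).
exists (\int[P]_w ln (1 + Y w)).
  by rewrite unlock /Rintegral fineK// (integrable_fin_num measurableT iln).
pose k := ln (1 + m) - (1 + m)^-1 * m.
have icst : P.-integrable [set: T] (EFin \o fun w => k).
  exact: finite_measure_integrable_cst.
have imul : P.-integrable [set: T] (EFin \o fun w => (1 + m)^-1 * Y w).
  exact: integrable_mulrl.
have tangentE : (fun w => ln (1 + m) + (Y w - m) / (1 + m)) =
    fun w => k + (1 + m)^-1 * Y w.
  by apply/funext => w; rewrite /k; ring.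
have ilin : P.-integrable [set: T]
    (EFin \o fun w => ln (1 + m) + (Y w - m) / (1 + m)).
  by rewrite tangentE; exact: integrable_addr.
have linE : \int[P]_w (ln (1 + m) + (Y w - m) / (1 + m)) = ln (1 + m).
  rewrite tangentE RintegralD// RintegralZl// Ym probability_Rintegral_cst.
  by rewrite /k subrK.
rewrite ler_distl; apply/andP; split; last first.
  rewrite ler_wpDr//; first by apply: Rintegral_ge0 => w _; exact: sqr_ge0.
  rewrite -[leRHS]linE; apply: le_Rintegral => // w _.
  exact: ln1D_upper.
rewrite -[X in X - _]linE -RintegralB//; apply: le_Rintegral => //.
- by have := integrableB measurableT ilin iV.
- by move=> w _; exact: ln1D_lower.
Qed.

End logarithm.

(** Every denominator is at least [rho^-1], so both fractions lie between 0 and [rho]. Hence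
    [L * delta <= rho * d], and [delta'] is a convex combination, with weights [1 / L] and
    [1 - 1 / L], of a number in [[0, rho]] and of [rho / (1 + delta)], where [delta] is at most
    [rho * d / L]. *)
Lemma fixed_point_bounds (R : realType) (d rho na : R) (L : nat) (delta delta' : R) :
  0 <= d -> 0 < rho -> (0 < L)%N -> 0 <= delta -> 0 <= delta' ->
  fixed_point d rho na L delta delta' ->
  L%:R * delta <= rho * d /\
  rho * (1 - (1 + rho * d) / L%:R) <= delta' <= rho.
Proof.
move=> d0 rho0 L0 delta0 delta'0 [].
have l0 : 0 < L%:R :> R by rewrite ltr0n.
have l1 : 1 <= L%:R :> R by rewrite ler1n.
move: (L%:R : R) l0 l1 => l l0 l1.
(* The two fractions have one shape, with [delta] and [delta' * d] exchanged. *)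
have frac_le (x y : R) : 0 <= x -> 0 <= y ->
    0 <= 1 / (rho^-1 * (1 + x) + na ^+ 2 / (l * (1 + y))) <= rho.
  move=> x0 y0.
  have h : rho^-1 <= rho^-1 * (1 + x) + na ^+ 2 / (l * (1 + y)).
    have t1 : 0 <= rho^-1 * x by rewrite mulr_ge0// invr_ge0 ltW.
    have t2 : 0 <= na ^+ 2 / (l * (1 + y)).
      by rewrite divr_ge0 ?sqr_ge0// mulr_ge0 ?addr_ge0// ltW.
    by rewrite mulrDr mulr1 -addrA lerDl addr_ge0.
  have h0 : 0 < rho^-1 * (1 + x) + na ^+ 2 / (l * (1 + y)).
    by rewrite (lt_le_trans _ h)// invr_gt0.
  rewrite div1r invr_ge0 ltW//=.
  by rewrite -[leRHS]invrK lef_pV2// posrE invr_gt0.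
have /andP[f0 f1] := frac_le _ _ (mulr_ge0 delta'0 d0) delta0.
have /andP[g0 g1] := frac_le _ _ delta0 (mulr_ge0 delta'0 d0).
rewrite -[d / _]mulr1 -mulrA [_^-1 * 1]mulrC.
move: (1 / _) f0 f1 => f f0 f1 deltaE.
move: (1 / _) g0 g1 => g g0 g1 delta'E.
have ldelta : l * delta = d * f by rewrite deltaE mulVKf// gt_eqF.
have h1 : l * delta <= rho * d by rewrite ldelta mulrC ler_wpM2r.
split => //.
have t0 : 0 < l^-1 by rewrite invr_gt0.
have t1 : l^-1 <= 1 by rewrite invf_le1.
have lt : l * l^-1 = 1 by rewrite divff// gt_eqF.
have u : 1 - delta <= (1 + delta)^-1 <= 1.
  apply/andP; split; last by rewrite invf_le1 ?lerDl// ltr_wpDr.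
  rewrite -div1r ler_pdivlMr ?ltr_wpDr//.
  have := sqr_ge0 delta; lra.
move: delta'E; rewrite [(l - 1) / l]mulrBl lt mul1r.
move: (1 + delta)^-1 u => q /andP[q0 q1] ->.
have dt : delta <= rho * d * l^-1 by rewrite ler_pdivlMr// mulrC.
move: (l^-1) t0 t1 {lt} dt => t t0 t1 dt.
apply/andP; split.
- have h2 : (1 - t) * rho * (1 - delta) <= (1 - t) * rho * q.
    by rewrite ler_wpM2l// mulr_ge0 ?subr_ge0// ltW.
  have h3 : 0 <= t * g by rewrite mulr_ge0// ltW.
  (* This is the gap between [rho * (1 - t) * (1 - delta)] and the claimed lower bound, with [t] for
     [1 / L]. *)
  have h4 : 0 <= rho * (t * delta + (rho * d * t - delta)).
    apply: mulr_ge0; first exact: ltW.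
    by apply: addr_ge0; [apply: mulr_ge0 => //; exact: ltW|rewrite subr_ge0].
  lra.
- have h2 : (1 - t) * rho * q <= (1 - t) * rho.
    by rewrite ler_piMr// mulr_ge0 ?subr_ge0// ltW.
  have h3 : t * g <= t * rho by rewrite ler_wpM2l// ltW.
  lra.
Qed.

(** The last two terms of [MI_bar] are bounded but need not be small. Each is within O(1/L) of
    [L * delta] in absolute value, so they cancel to that order; the first logarithm accounts for
    [ln (1 + rho * d)]. *)
Lemma MI_bar_asymptotics (R : realType) (d rho na : R) (L : nat) (delta delta' : R) :
  0 <= d -> 0 < rho -> (0 < L)%N -> 0 <= delta -> 0 <= delta' ->
  fixed_point d rho na L delta delta' ->
  `|MI_bar d rho na L delta delta' - ln (1 + rho * d)| <=
  (2 * (rho * d * (1 + rho * d)) + rho * na ^+ 2 + (rho * d) ^+ 2) / L%:R.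
Proof.
move=> d0 rho0 L0 delta0 delta'0 fp.
have [h1 /andP[h2 h3]] := fixed_point_bounds d0 rho0 L0 delta0 delta'0 fp.
rewrite /MI_bar; have l0 : 0 < L%:R :> R by rewrite ltr0n.
move: (L%:R : R) l0 h1 h2 => l l0 h1 h2 {fp}.
have t0 : 0 < l^-1 by rewrite invr_gt0.
have r0 := ltW rho0.
have n0 := sqr_ge0 na; move: (na ^+ 2) n0 => na2 n0.
have ll0 := ltW l0.
pose s := rho * na2 / (l * (1 + delta)).
have s0 : 0 <= s by rewrite divr_ge0 ?mulr_ge0 ?addr_ge0.
have s1 : s <= rho * na2 / l.
  rewrite ler_wpM2l ?mulr_ge0// lef_pV2 ?posrE ?mulr_gt0 ?ltr_wpDr//.
  by rewrite ler_peMr ?lerDl// ltW.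
have g0 : 0 <= rho - delta' <= rho * (1 + rho * d) / l.
  by apply/andP; split; lra.
have {h2 h3 g0} [/andP[g0 g1] g] := (g0, erefl (rho - delta')).
have part1 : `|ln `|1 + delta' * d + s| - ln (1 + rho * d)| <=
    (rho * d * (1 + rho * d) + rho * na2) / l.
  rewrite [X in ln X - _]ger0_norm; last first.
    by apply: addr_ge0 => //; apply: addr_ge0 => //; exact: mulr_ge0.
  apply: (le_trans (ln_lipschitz _ _)).
  - by rewrite -addrA lerDl addr_ge0// mulr_ge0.
  - by rewrite lerDl mulr_ge0.
  rewrite (_ : _ - _ = s - d * (rho - delta')); last by ring.
  have dg0 : 0 <= d * (rho - delta') by rewrite mulr_ge0.
  have dg1 : d * (rho - delta') <= d * (rho * (1 + rho * d) / l).
    by rewrite ler_wpM2l.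
  have nn : 0 <= rho * na2 / l by rewrite !mulr_ge0// ltW.
  rewrite mulrDl ler_norml; apply/andP; split; lra.
(* The tangent bounds at 0 give [delta - delta^2 <= ln (1 + delta) <= delta], and [l * delta^2]
   equals [(l * delta)^2 / l]. *)
have part2 : `|l * ln (1 + delta) - l * delta| <= (rho * d) ^+ 2 / l.
  have dd : l * delta ^+ 2 <= (rho * d) ^+ 2 / l.
    rewrite ler_pdivlMr//.
    rewrite (_ : _ * l = (l * delta) ^+ 2); last by ring.
    by rewrite lerXn2r// nnegrE mulr_ge0// ltW.
  have := ln1D_lower delta0 (lexx 0).
  have := ln1D_upper delta0 (lexx 0).
  rewrite !addr0 ln1 add0r subr0 divr1 => u1 u2.
  have : l * (delta - delta ^+ 2) <= l * ln (1 + delta) by rewrite ler_wpM2l// ltW.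
  have : l * ln (1 + delta) <= l * delta by rewrite ler_wpM2l// ltW.
  have : 0 <= (rho * d) ^+ 2 / l by rewrite divr_ge0 ?sqr_ge0// ltW.
  by rewrite ler_norml => *; apply/andP; split; lra.
have part3 : `|l * delta - rho^-1 * l * delta * delta'| <=
    rho * d * (1 + rho * d) / l.
  rewrite (_ : _ - _ = l * delta * ((rho - delta') / rho)); last first.
    by field; rewrite gt_eqF.
  rewrite ger0_norm; last by rewrite !mulr_ge0 ?invr_ge0// ltW.
  apply: (@le_trans _ _ (rho * d * (rho * (1 + rho * d) / l / rho))).
    by rewrite ler_pM ?mulr_ge0 ?invr_ge0// ?ler_wpM2r ?invr_ge0// ltW.
  by rewrite le_eqVlt; apply/orP; left; apply/eqP; field; rewrite !gt_eqF.
move: part1 part2 part3; rewrite -/s !ler_norml.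
move=> /andP[a1 a2] /andP[b1 b2] /andP[c1 c2].
by rewrite !mulrDl in a1 a2 *; apply/andP; split; lra.
Qed.

(** * Reduction of the determinant *)

(** Take determinants in two block triangular factorizations of [N], one for each Schur
    complement. *)
Lemma det_1mulmxC (R : comNzRingType) m n (A : 'M[R]_(m, n)) (B : 'M[R]_(n, m)) :
  \det (1%:M + A *m B) = \det (1%:M + B *m A).
Proof.
pose N := block_mx 1%:M (- A) B 1%:M.
have e1 : block_mx 1%:M 0 B 1%:M *m block_mx 1%:M (- A) 0 (1%:M + B *m A) = N.
  rewrite mulmx_block !(mul1mx, mulmx1, mul0mx, mulmx0, add0r, addr0).
  by rewrite mulmxN addrC addrK.
have e2 : block_mx 1%:M (- A) 0 1%:M *m block_mx (1%:M + A *m B) 0 B 1%:M = N.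
  rewrite mulmx_block !(mul1mx, mulmx1, mul0mx, mulmx0, add0r, addr0).
  by rewrite mulNmx addrK.
have := congr1 determinant (etrans e1 (esym e2)).
by rewrite !det_mulmx !det_lblock !det_ublock !det1 !mul1r mulr1 => ->.
Qed.

(** The size is given by an equation because a Kronecker product of 1 by 1 matrices has size
    [1 * 1]. *)
Lemma det_mx_dim1 (R : comNzRingType) m (A : 'M[R]_m) (i : 'I_m) :
  m = 1%N -> \det A = A i i.
Proof. by move=> m1; subst m; rewrite det_mx11 (ord1 i). Qed.

Section complex_vectors.
Context {R : realType}.

(** Real and imaginary parts appear separately so that the norm is a polynomial in the real Gaussian
    variables. *)
Definition rownorm2 n (z : 'rV[R[i]]_n) : R :=
  \sum_j (complex.Re (z 0 j) ^+ 2 + complex.Im (z 0 j) ^+ 2).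

Lemma mulcJ (z : R[i]) :
  z * z^*%C = (complex.Re z ^+ 2 + complex.Im z ^+ 2)%:C.
Proof.
case: z => a b; apply/eqP; rewrite eq_complex /=; apply/andP; split; apply/eqP; ring.
Qed.

Lemma row_mul_adjE n (z : 'rV[R[i]]_n) : (z *m z^t*) 0 0 = (rownorm2 z)%:C.
Proof.
rewrite mxE /rownorm2 rmorph_sum /=; apply: eq_bigr => j _.
by rewrite -mulcJ !mxE.
Qed.

Lemma rownorm2_ge0 n (z : 'rV[R[i]]_n) : 0 <= rownorm2 z.
Proof. by apply: sumr_ge0 => j _; rewrite addr_ge0 ?sqr_ge0. Qed.

Lemma adjmxK m n (A : 'M[R[i]]_(m, n)) : A^t*^t* = A.
Proof. by apply/matrixP => i j; rewrite !mxE conjCK. Qed.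

Lemma adjmxM m n p (A : 'M[R[i]]_(m, n)) (B : 'M[R[i]]_(n, p)) :
  (A *m B)^t* = B^t* *m A^t*.
Proof. by rewrite trmx_mul map_mxM. Qed.

Lemma enorm_sqr n (v : 'cV[R[i]]_n) : enorm v ^+ 2 = rownorm2 (v^t*).
Proof.
rewrite /enorm sqr_sqrtr; last first.
  by apply: sumr_ge0 => k _; exact: sqr_ge0.
apply: eq_bigr => k _; rewrite !mxE.
case: (v k 0) => a b /=; rewrite sqr_sqrtr ?addr_ge0 ?sqr_ge0//.
by rewrite sqrrN.
Qed.

Lemma qformE n (v : 'cV[R[i]]_n) (F : 'M[R[i]]_n) :
  qform v F = rownorm2 (v^t* *m F).
Proof.
rewrite /qform.
have -> : v^t* *m (F *m F^t*) *m v = (v^t* *m F) *m (v^t* *m F)^t*.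
  by rewrite adjmxM adjmxK !mulmxA.
by rewrite row_mul_adjE.
Qed.

Lemma tr_outerE n (v : 'cV[R[i]]_n) : \tr (outer v) = (rownorm2 (v^t*))%:C.
Proof.
rewrite /outer mxtrace_mulC -row_mul_adjE adjmxK.
by rewrite /mxtrace big_ord_recl big_ord0 addr0.
Qed.

(** The determinant identity acts twice: it first brings the two factors [B] together, so that only
    [B *m B] matters, and then turns the resulting rank-one matrix into a scalar. *)
Lemma det_outer_tens Nt Nr (at_ : 'cV[R[i]]_Nt) (ar : 'cV[R[i]]_Nr)
    (B M : 'M[R[i]]_Nt) (c : R[i]) :
  B *m B = outer at_ ->
  \det (1%:M + c *: (outer ar *t (B *m M *m B))) =
  1 + c * ((ar^t* *m ar) 0 0 * (at_^t* *m M *m at_) 0 0).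
Proof.
move=> BB.
have -> : outer ar *t (B *m M *m B) = (outer ar *t (B *m M)) *m (1%:M *t B).
  by rewrite tensmx_mul mulmx1.
rewrite scalemxAl det_1mulmxC -scalemxAr tensmx_mul mul1mx mulmxA BB.
rewrite /outer -[at_ *m _ *m M]mulmxA -tensmx_mul scalemxAl det_1mulmxC.
rewrite -scalemxAr tensmx_mul.
set x := ar^t* *m ar; set y := at_^t* *m M *m at_.
transitivity ((1%:M + c *: (x *t y)) (mxtens_index (0, 0)) (mxtens_index (0, 0))).
  exact: det_mx_dim1.
by rewrite mxE mxE eqxx [X in _ + X]mxE tensmxE.
Qed.

Lemma sensing_logdetE Nt Nr (at_ : 'cV[R[i]]_Nt) (ar : 'cV[R[i]]_Nr)
    (Rt12 : 'M[R[i]]_Nt) (alpha : R[i]) (sigma2 : R) (L : nat)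
    (X : 'M[R[i]]_(Nt, L)) :
  Rt12 *m Rt12 = outer at_ ->
  sensing_logdet ar Rt12 alpha sigma2 X =
  ln (1 + snr ar alpha sigma2 / L%:R * rownorm2 (at_^t* *m X)).
Proof.
move=> BB; rewrite /sensing_logdet.
have -> : Rt12 *m X *m X^t* *m Rt12 = Rt12 *m (X *m X^t*) *m Rt12.
  by rewrite !mulmxA.
rewrite (det_outer_tens _ _ _ BB).
have -> : at_^t* *m (X *m X^t*) *m at_ = (at_^t* *m X) *m (at_^t* *m X)^t*.
  by rewrite adjmxM adjmxK !mulmxA.
have -> : ar^t* *m ar = ar^t* *m (ar^t*)^t* by rewrite adjmxK.
rewrite !row_mul_adjE /snr tr_outerE /=; congr ln.
by rewrite invfM; ring.
Qed.

End complex_vectors.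

(** * Complex Gaussian matrices *)

Lemma big_option (R : Type) (idx : R) (op : Monoid.com_law idx) (I : finType)
    (F : option I -> R) :
  \big[op/idx]_a F a = op (F None) (\big[op/idx]_i F (Some i)).
Proof.
rewrite (bigD1 None)//=; congr (op _ _).
rewrite (@reindex_omap _ _ _ _ _ Some id) => [|[]]//=.
by apply: eq_bigl => i; rewrite eqxx.
Qed.

Lemma big_pair (R : Type) (idx : R) (op : Monoid.com_law idx) (I J : finType)
    (F : I * J -> R) :
  \big[op/idx]_p F p = \big[op/idx]_i \big[op/idx]_j F (i, j).
Proof. by rewrite pair_bigA; apply: eq_bigr => -[]. Qed.

Section iid_complex_gaussian.
Context {R : realType} d (T : measurableType d) (P : probability T R).
Variables (m n : nat) (S : T -> 'M[R[i]]_(m, n)).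
Hypothesis iidS : iid_std_complex_gaussian P S.

Local Notation hnormal := (normal_prob (0 : R) (Num.sqrt 2^-1)).

Definition re_or_im (c : bool) (z : R[i]) : R :=
  if c then complex.Re z else complex.Im z.

(** The index has the shape [I * J] of the column forms: [J] numbers the columns, and [I] pairs a
    row with the choice of real or imaginary part. *)
Definition real_part (k : ('I_m * bool) * 'I_n) (w : T) : R :=
  re_or_im k.1.2 (S w k.1.1 k.2).

Lemma measurable_real_part k : measurable_fun [set: T] (real_part k).
Proof.
case: iidS => mS _ _; case: k => -[i r] j.
case: r; rewrite /real_part /=.
  exact: (measurableT_comp measurable_fst (mS i j)).
exact: (measurableT_comp measurable_snd (mS i j)).
Qed.

(** On rectangles, the product rule for complex entries splits further, because the complex Gaussian
    law is itself a product measure. *)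
Lemma real_part_independent (B : ('I_m * bool) * 'I_n -> set R) :
  (forall k, measurable (B k)) ->
  P [set w | forall k, B k (real_part k w)] = (\prod_k hnormal (B k))%E.
Proof.
move=> mB; case: iidS => mS lawS indepS.
pose A i j := B ((i, true), j) `*` B ((i, false), j).
have mA i j : measurable (A i j) by exact: measurableX.
have -> : [set w | forall k, B k (real_part k w)] =
    [set w | forall i j, A i j (reim (S w i j))].
  apply/seteqP; split => w h; last by move=> [[i []] j]; case: (h i j).
  by move=> i j; split; [exact: (h (i, true, j))|exact: (h (i, false, j))].
rewrite (indepS A mA).
rewrite !big_pair/=.
apply: eq_bigr => i _; rewrite big_bool /= -big_split /=.
apply: eq_bigr => j _; rewrite (lawS i j _ (mA i j)).
by rewrite /std_complex_gaussian product_measure1E; [|exact: mB|exact: mB].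
Qed.

Section affine_rows.
Variables (f : 'rV[R[i]]_m) (b : 'rV[R[i]]_n).

(** The real form of complex multiplication by [f 0 k]; the entry of [b] multiplies the constant
    atom. *)
Definition row_coef (c : bool) (j : 'I_n) (a : option ('I_m * bool)) : R :=
  match a with
  | None => re_or_im c (b 0 j)
  | Some (k, r) =>
    if c then (if r then complex.Re (f 0 k) else - complex.Im (f 0 k))
    else (if r then complex.Im (f 0 k) else complex.Re (f 0 k))
  end.

Lemma row_entry_sumE w c j :
  \sum_a row_coef c j a * atom real_part a j w =
  re_or_im c ((b + f *m S w) 0 j).
Proof.
rewrite big_option /= mulr1 big_pair/=.
rewrite !mxE; case: c => /=.
- rewrite raddfD /=; congr +%R; rewrite raddf_sum /=; apply: eq_bigr => k _.
  rewrite big_bool /= /real_part /=.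
  by case: (f 0 k) => ? ?; case: (S w k j) => ? ? /=; ring.
- rewrite raddfD /=; congr +%R; rewrite raddf_sum /=; apply: eq_bigr => k _.
  rewrite big_bool /= /real_part /=.
  by case: (f 0 k) => ? ?; case: (S w k j) => ? ? /=; ring.
Qed.

Lemma rownorm2_total_form w :
  rownorm2 (b + f *m S w) = total_form real_part row_coef w.
Proof.
apply: eq_bigr => j _; rewrite /col_form big_bool /=.
by rewrite !row_entry_sumE.
Qed.

(** Each [|f_k|^2] occurs twice, in the real and in the imaginary part, which compensates the
    variance 1/2. *)
Lemma row_coef_variance :
  \sum_j \sum_c \sum_a row_coef c j a ^+ 2 * atom_var hnormal a =
  rownorm2 b + n%:R * rownorm2 f.
Proof.
have -> : n%:R * rownorm2 f = \sum_(j < n) rownorm2 f.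
  by rewrite sumr_const card_ord mulr_natl.
rewrite -big_split /=; apply: eq_bigr => j _.
rewrite big_bool /=.
rewrite !big_option /= half_normal_variance !mulr1 addrACA; congr +%R.
rewrite -big_split big_pair/=.
by apply: eq_bigr => k _; rewrite big_bool /=; field.
Qed.

Lemma row_coef_bound B : 0 <= B -> rownorm2 f <= B ^+ 2 ->
  rownorm2 b <= B ^+ 2 -> forall c j a, `|row_coef c j a| <= B.
Proof.
move=> B0 fB bB.
have part_le p (z : 'rV[R[i]]_p) l : rownorm2 z <= B ^+ 2 ->
    `|complex.Re (z 0 l)| <= B /\ `|complex.Im (z 0 l)| <= B.
  rewrite /rownorm2 (bigD1 l)//= => zB.
  have rest : 0 <= \sum_(j | j != l)
      (complex.Re (z 0 j) ^+ 2 + complex.Im (z 0 j) ^+ 2).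
    by apply: sumr_ge0 => j _; rewrite addr_ge0 ?sqr_ge0.
  have re2 := sqr_ge0 (complex.Re (z 0 l)).
  have im2 := sqr_ge0 (complex.Im (z 0 l)).
  by split; rewrite -(@ler_pXn2r _ 2) ?nnegrE// real_normK ?num_real//; lra.
have fP k := part_le _ _ k fB; have bP j := part_le _ _ j bB.
move=> c j [[k r]|] /=; last by case: c; [exact: (bP j).1|exact: (bP j).2].
by case: c; case: r; rewrite ?normrN; first [exact: (fP k).1|exact: (fP k).2].
Qed.

End affine_rows.
End iid_complex_gaussian.

(** * Concentration of the mutual information and conclusion *)

Lemma snr_gt0 (R : realType) Nr (ar : 'cV[R[i]]_Nr) (alpha : R[i]) (sigma2 : R) :
  ar != 0 -> alpha != 0 -> 0 < sigma2 -> 0 < snr ar alpha sigma2.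
Proof.
move=> ar0 alpha0 sigma0; rewrite /snr tr_outerE /=; apply: mulr_gt0.
  apply: mulr_gt0; last by rewrite invr_gt0.
  rewrite exprn_gt0// lt_neqAle eq_sym; apply/andP; split.
    by apply: contra alpha0 => /eqP/ComplexField.Normc.eq0_normc ->.
  by case: (alpha) => a b /=; exact: sqrtr_ge0.
rewrite lt_neqAle rownorm2_ge0 andbT eq_sym; apply: contra ar0 => /eqP.
move=> ar2; apply/eqP/matrixP => k l; rewrite (ord1 l) mxE.
have : \sum_j (complex.Re ((ar^t*) 0 j) ^+ 2 + complex.Im ((ar^t*) 0 j) ^+ 2) == 0.
  by apply/eqP.
rewrite psumr_eq0 => [/allP/(_ k (mem_index_enum _))|j _]; last first.
  by rewrite addr_ge0 ?sqr_ge0.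
rewrite /= paddr_eq0 ?sqr_ge0// !sqrf_eq0 !mxE.
by case: (ar k 0) => a b /=; rewrite oppr_eq0 => /andP[/eqP -> /eqP ->].
Qed.

Section mutual_information.
Context {R : realType} (Nt Nr : nat).
Variables (at_ : 'cV[R[i]]_Nt) (ar : 'cV[R[i]]_Nr) (alpha : R[i]) (sigma2 : R).
Variables (F Rt12 : 'M[R[i]]_Nt).
Hypothesis Rt12E : Rt12 *m Rt12 = outer at_.

Local Notation rho := (snr ar alpha sigma2).
Local Notation d := (qform at_ F).
Local Notation na := (enorm at_).
Local Notation hnormal := (normal_prob (0 : R) (Num.sqrt 2^-1)).

(** The scaling [(rho / L)^2] of a variance of order [L] leaves [rho ^+ 2 / L]. The last argument
    bounds the coefficients: its square dominates both [d] and [na ^+ 2], without a square root. *)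
Definition MI_variance_const : R :=
  rho ^+ 2 * col_sqr_bound hnormal ('I_Nt * bool)%type (1 + d + na ^+ 2).

Lemma sensing_MI_concentration (L : nat) (Sp : 'M[R[i]]_(Nt, L))
    (disp : measure_display) (T : measurableType disp) (P : probability T R)
    (Sd : T -> 'M[R[i]]_(Nt, L)) :
  0 < rho -> (0 < L)%N -> Sp *m Sp^t* = 1%:M -> iid_std_complex_gaussian P Sd ->
  exists2 e : R,
    sensing_MI ar Rt12 alpha sigma2 P (fun w => Sp + F *m Sd w) = e%:E &
    `|e - ln (1 + rho * (na ^+ 2 / L%:R + d))| <= MI_variance_const / L%:R.
Proof.
move=> rho0 L0 SpE iidSd.
pose f := at_^t* *m F; pose b := at_^t* *m Sp.
have fd : rownorm2 f = d by rewrite qformE.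
(* Orthonormal pilot rows preserve the norm of [at_], whatever [L] is. *)
have bna : rownorm2 b = na ^+ 2.
  apply: complexI; rewrite enorm_sqr -!row_mul_adjE /b adjmxM.
  by rewrite -mulmxA [Sp *m _]mulmxA SpE mul1mx.
have d0 : 0 <= d by rewrite -fd rownorm2_ge0.
have na0 : 0 <= na ^+ 2 by exact: sqr_ge0.
have B0 : 0 <= 1 + d + na ^+ 2 by rewrite !addr_ge0.
have B2 : d + na ^+ 2 <= (1 + d + na ^+ 2) ^+ 2.
  move: (na ^+ 2) na0 => a a0; have := mulr_ge0 d0 a0; nra.
pose Z := real_part Sd.
pose W := total_form Z (row_coef f b).
have mZ : forall k, measurable_fun [set: T] (Z k) := measurable_real_part iidSd.
have indZ := real_part_independent iidSd.
have n4 : forall n, (n <= 4)%N -> hnormal.-integrable [set: R]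
  (fun x => (x ^+ n)%:E) := @integrable_half_normal_expr R.
have n1 := @half_normal_mean R.
have alphaB : forall c j a, `|row_coef f b c j a| <= 1 + d + na ^+ 2.
  apply: row_coef_bound => //; first by rewrite fd; lra.
  by rewrite bna; lra.
have l0 : 0 < L%:R :> R by rewrite ltr0n.
have EW : \int[P]_w W w = na ^+ 2 + L%:R * d.
  by rewrite /W (Rintegral_total_form mZ indZ n4 n1) row_coef_variance bna fd.
have varW := total_form_variance_le mZ indZ n4 alphaB.
pose Y w := rho / L%:R * W w.
have r0 : 0 <= rho / L%:R by rewrite divr_ge0// ltW.
have Y0 w : 0 <= Y w by rewrite mulr_ge0// /W -rownorm2_total_form rownorm2_ge0.
have iW : P.-integrable [set: T] (EFin \o W) := integrable_total_form mZ indZ n4 _.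
have EY : \int[P]_w Y w = rho * (na ^+ 2 / L%:R + d).
  by rewrite RintegralZl// EW; field; rewrite gt_eqF.
have YE : (fun w => (Y w - rho * (na ^+ 2 / L%:R + d)) ^+ 2) =
    fun w => (rho / L%:R) ^+ 2 * (W w - \int[P]_w' W w') ^+ 2.
  by apply/funext => w; rewrite EW /Y; field; rewrite gt_eqF.
have idev := integrable_total_form_dev mZ indZ n4 (row_coef f b) (\int[P]_w' W w').
have iV : P.-integrable [set: T]
    (EFin \o fun w => (Y w - rho * (na ^+ 2 / L%:R + d)) ^+ 2).
  by rewrite YE; exact: integrable_mulrl.
have [e eE e_le] := expectation_ln1D Y0 (integrable_mulrl _ iW) EY iV.
exists e.
  rewrite -eE /sensing_MI; congr ('E_P[_])%E; apply/funext => w.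
  rewrite (sensing_logdetE _ _ _ _ Rt12E) mulmxDr mulmxA.
  by rewrite rownorm2_total_form.
apply: (le_trans e_le); rewrite YE RintegralZl//.
apply: (@le_trans _ _ ((rho / L%:R) ^+ 2 *
    (L%:R * col_sqr_bound hnormal ('I_Nt * bool)%type (1 + d + na ^+ 2)))).
  by rewrite ler_wpM2l ?sqr_ge0//; move: varW; rewrite card_ord.
rewrite le_eqVlt /MI_variance_const; apply/orP; left; apply/eqP.
by field; rewrite gt_eqF.
Qed.

End mutual_information.

Unset Implicit Arguments.
Set Strict Implicit.
Set Printing Implicit Defensive.

Theorem proposition1 (R : realType) (Nt Nr : nat)
  (at_ : 'cV[R[i]]_Nt) (ar : 'cV[R[i]]_Nr) (alpha : R[i]) (sigma2 : R)
  (F Rt12 : 'M[R[i]]_Nt) :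
  at_ != 0 -> ar != 0 -> alpha != 0 -> 0 < sigma2 ->
  is_psd_sqrt (outer at_) Rt12 ->
  let rho := snr ar alpha sigma2 in
  let d := qform at_ F in
  exists C : R,
  forall (Sp : forall L : nat, 'M[R[i]]_(Nt, L))
    (disp : nat -> measure_display)
    (T : forall L : nat, measurableType (disp L))
    (P : forall L : nat, probability (T L) R)
    (Sd : forall L : nat, T L -> 'M[R[i]]_(Nt, L))
    (delta delta' : nat -> R),
  (forall L : nat, (Nt <= L)%N ->
    [/\ Sp L *m (Sp L)^t* = 1%:M,
        iid_std_complex_gaussian (P L) (Sd L),
        0 <= delta L, 0 <= delta' L
      & fixed_point d rho (enorm at_) L (delta L) (delta' L)]) ->
  \forall L \near \oo,
    (`| sensing_MI ar Rt12 alpha sigma2 (P L)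
          (fun w : T L => Sp L + F *m Sd L w)%R
        - (MI_bar d rho (enorm at_) L (delta L) (delta' L))%:E |
     <= (C / L%:R)%:E)%E.
Proof.
move=> _ ar0 alpha0 sigma0 [_ Rt12E] rho d.
have rho0 : 0 < rho by exact: snr_gt0.
have d0 : 0 <= d by rewrite /d qformE rownorm2_ge0.
(* Three errors add up: the fluctuation of [Y], the pilot share of its mean, and the deviation of
   [MI_bar]. *)
exists (MI_variance_const at_ ar alpha sigma2 F + rho * enorm at_ ^+ 2 +
  (2 * (rho * d * (1 + rho * d)) + rho * enorm at_ ^+ 2 + (rho * d) ^+ 2)).
move=> Sp disp T P Sd delta delta' H; near=> L.
have L0 : (0 < L)%N by near: L; exists 1%N.
have NtL : (Nt <= L)%N by near: L; exists Nt.
have [SpE iidSd delta0 delta'0 fp] := H L NtL.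
have [e -> e_le] := sensing_MI_concentration F Rt12E rho0 L0 SpE iidSd.
have bar_le := MI_bar_asymptotics d0 rho0 L0 delta0 delta'0 fp.
have ln_le : `|ln (1 + rho * (enorm at_ ^+ 2 / L%:R + d)) - ln (1 + rho * d)| <=
    rho * enorm at_ ^+ 2 / L%:R.
  have l0 : 0 <= rho * enorm at_ ^+ 2 / L%:R :> R.
    by rewrite divr_ge0// mulr_ge0 ?sqr_ge0// ltW.
  have rd0 : 0 <= rho * d by rewrite mulr_ge0// ltW.
  apply: (le_trans (ln_lipschitz _ _)).
  - by rewrite lerDl mulrDr addr_ge0// mulrA.
  - by rewrite lerDl.
  rewrite (_ : _ - _ = rho * enorm at_ ^+ 2 / L%:R); last by ring.
  by rewrite ger0_norm.
rewrite -EFinB abse_EFin lee_fin !mulrDl.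
move: e_le bar_le ln_le; rewrite -/rho -/d !mulrDl.
rewrite !ler_norml => /andP[? ?] /andP[? ?] /andP[? ?].
by apply/andP; split; lra.
Unshelve. all: by end_near. Qed.
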